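(* Let $n\ge 2$, $0\le r\le n-2$, and let $X$ be a contractible pure $n$-dimensional simplicial complex such that all links of $X$ of dimension $>0$ are connected and the links of all simplices of dimension $r$ are finite. Let $\Gamma$ be a locally compact, unimodular group of automorphisms of $X$ acting cocompactly on $X$ such that the stabilizer $\Gamma_\sigma$ of every simplex $\sigma$ of dimension $r$ is compact, and let $m$ be a $\Gamma$-invariant weight function on $X$ with constants $C_i$ ($r\le i\le n-1$). Let $r+1\le k\le n-1$. If $$\lambda_k:=\min_{\tau\in\Sigma(k-1)}\lambda(X_\tau)>C_k\frac{k}{k+1},$$ then $\Gamma$ has property (T).
   Context: Pure: every simplex is contained in an $n$-simplex. Cocompact: finitely many $\Gamma$-orbits of simplices. $\Sigma(k)$ is the set of ordered $k$-simplices of $X$. Stabilizers $\Gamma_\sigma$ are point-wise; for $\dim\sigma\ge r$ they are compact with Haar measure $0<|\Gamma_\sigma|<\infty$. Weight function: $m:\bigcup_{k\ge r}\Sigma(k)\to\mathbb{R}^+$ (positive values) with $m(\gamma\sigma)=m(\sigma)$ for $\gamma\in\Gamma$, $m$ independent of the ordering of a simplex, and for each $r\le k\le n-1$ a constant $C_k$ such that for every $\tau\in\Sigma(k)$, $\sum_{\sigma\in\Sigma(k+1),\,\tau\subset\sigma}m(\sigma)=(k+2)!\,C_k\,m(\tau)$, where $\tau\subset\sigma$ means that all vertices of $\tau$ are vertices of $\sigma$ (regardless of order). Eigenvalue: for an ordered simplex $\tau\in\Sigma(k-1)$, $k-1\ge r$, the link $X_\tau$ is a finite complex; put $m_\tau(\sigma)=m(\tau\sigma)$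 for ordered simplices $\sigma$ of $X_\tau$ ($\tau\sigma$ is concatenation). The untwisted Laplacian on real functions on the vertices of $X_\tau$ is $\Delta_\tau^+f(u)=C_kf(u)-\frac1{m_\tau(u)}\sum_{v:(u,v)\text{ edge of }X_\tau}m_\tau((u,v))f(v)$; $\lambda(X_\tau)$ is its smallest positive eigenvalue. Property (T): a topological group $\Gamma$ has property (T) if there are $\kappa>0$ and a compact $Q\subset\Gamma$ such that every unitary representation $\rho$ of $\Gamma$ on a complex Hilbert space $H$ either has a nonzero invariant vector or satisfies $\max_{\gamma\in Q}|\rho(\gamma)\xi-\xi|\ge\kappa$ for every unit vector $\xi\in H$. *)

(* Defs.v *)
From HB Require Import structures.
From mathcomp Require Import all_boot all_order all_algebra.
From mathcomp Require Import sesquilinear finmap complex.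
From mathcomp Require Import all_classical all_reals all_analysis.

Set Implicit Arguments.
Unset Strict Implicit.
Unset Printing Implicit Defensive.

Import Order.TTheory GRing.Theory Num.Theory.
Import numFieldNormedType.Exports.

Local Open Scope classical_set_scope.
Local Open Scope ring_scope.

(* A simplex of dimension k is a face of cardinality k.+1. The vertices of the
   complex are the v such that [fset v] is a face; other elements of V play no
   role, so that the link of a simplex is again a complex on V. *)
Record simplicial_complex (V : choiceType) := SimplicialComplex {
  face : set {fset V};
  face_neq0 : forall s, face s -> s != fset0;
  face_sub : forall s t, face t -> (s `<=` t)%fset -> s != fset0 -> face s }.

Section complexes.
Variables (V : choiceType) (X : simplicial_complex V).

Definition vertex (v : V) : Prop := face X [fset v]%fset.

Definition pure_of_dim (n : nat) : Prop :=
  (forall s, face X s -> (#|` s| <= n.+1)%N) /\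
  (forall s, face X s -> exists t, [/\ face X t, (s `<=` t)%fset & #|` t| = n.+1]).

Definition positive_dim : Prop := exists2 s, face X s & (1 < #|` s|)%N.

Definition ordered_simplex (k : nat) : set (seq V) :=
  [set s | [/\ uniq s, size s = k.+1 & face X [fset v in s]%fset]].

Section link.
Variable t : {fset V}.

Definition link_face : set {fset V} :=
  [set s | [/\ s != fset0, [disjoint t & s]%fset & face X (t `|` s)%fset]].

Lemma link_face_neq0 s : link_face s -> s != fset0.
Proof. by case. Qed.

Lemma link_face_sub s u :
  link_face u -> (s `<=` u)%fset -> s != fset0 -> link_face s.
Proof.
move=> [u0 tu Xtu] su s0; split => //.
  exact: fdisjointWr su tu.
apply: (face_sub Xtu); first exact: fsetUS.
by rewrite fsetU_eq0 negb_and s0 orbT.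
Qed.

Definition link : simplicial_complex V :=
  SimplicialComplex link_face_neq0 link_face_sub.
End link.
End complexes.

(* Points of the geometric realization, given by barycentric coordinates. *)
Record realization (R : realType) (V : choiceType) (X : simplicial_complex V) :=
  Realization {
    coord :> V -> R;
    coord_ge0 : forall v, 0 <= coord v;
    coord_sum1 : exists s : {fset V},
      [/\ face X s, forall v, v \notin s -> coord v = 0 & \sum_(v <- s) coord v = 1] }.

Section realization_topology.
Variables (R : realType) (V : choiceType) (X : simplicial_complex V).

HB.instance Definition _ := gen_eqMixin (realization R X).
HB.instance Definition _ := gen_choiceMixin (realization R X).

Definition closed_simplex (s : {fset V}) : set (realization R X) :=
  [set p | forall v, v \notin s -> p v = 0].

(* The weak (coherent) topology: U is open iff its trace on every closed simplex
   is open; on a single closed simplex, pointwise convergence of the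
   coordinates is the Euclidean topology. *)
Definition realization_open : set_system (realization R X) :=
  [set U | forall s, face X s -> exists2 W : set {ptws V -> R}, open W &
     U `&` closed_simplex s = [set p | W (coord p)] `&` closed_simplex s].

Lemma realization_openT : realization_open setT.
Proof. by move=> s _; exists setT; first exact: openT. Qed.

Lemma realization_openI : setI_closed realization_open.
Proof.
move=> A B oA oB s Xs.
have [W oW AW] := oA s Xs; have [W' oW' BW'] := oB s Xs.
exists (W `&` W'); first exact: openI.
by rewrite setIIl AW BW' -setIIl.
Qed.

Lemma realization_open_bigU (I : Type) (f : I -> set (realization R X)) :
  (forall i, realization_open (f i)) -> realization_open (\bigcup_i f i).
Proof.
move=> of_ s Xs.
have /choice[W HW] : forall i, exists W : set {ptws V -> R}, open W /\
    f i `&` closed_simplex s = [set p | W (coord p)] `&` closed_simplex s.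
  by move=> i; have [W oW fW] := of_ i s Xs; exists W.
exists (\bigcup_i W i); first by apply: bigcup_open => i _; have [] := HW i.
apply/seteqP; split => p [[i _ fip] sp]; split => //; exists i => //.
  have : (f i `&` closed_simplex s) p by [].
  by rewrite (HW i).2 => -[].
have : ([set p | W i (coord p)] `&` closed_simplex s) p by [].
by rewrite -(HW i).2 => -[].
Qed.

HB.instance Definition _ := isOpenTopological.Build (realization R X)
  realization_openT realization_openI realization_open_bigU.
End realization_topology.

Definition contractible (R : realType) (T : topologicalType) : Prop :=
  exists (x0 : T) (h : T * R -> T),
    [/\ {within [set z : T * R | 0 <= z.2 <= 1], continuous h},
        forall x, h (x, 0) = x & forall x, h (x, 1) = x0].

HB.mixin Record isTopGroup G of Group G & PointedTopological G := {
  mulg_continuous : continuous (fun z : G * G => (z.1 * z.2)%g);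
  invg_continuous : continuous (fun x : G => (x^-1)%g) }.

#[short(type="topGroupType")]
HB.structure Definition TopGroup :=
  {G of isTopGroup G & Group G & PointedTopological G}.

Definition borel (T : ptopologicalType) : Type := g_sigma_algebraType (@open T).

Section haar.
Variables (R : realType) (G : topGroupType).
Implicit Type mu : {measure set (borel G) -> \bar R}.

Record left_haar_measure mu : Prop := LeftHaar {
  haar_left_invariant : forall (g : G) (A : set (borel G)), measurable A ->
    mu [set (g * x)%g | x in A] = mu A;
  haar_compact : forall K : set G, compact K -> (mu K < +oo)%E;
  haar_open : forall U : set G, open U -> U !=set0 -> (0 < mu U)%E;
  haar_outer_regular : forall A : set (borel G), measurable A ->
    mu A = ereal_inf [set mu U | U in [set U : set G | open U /\ A `<=` U]];
  haar_inner_regular : forall U : set G, open U ->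
    mu U = ereal_sup [set mu K | K in [set K : set G | compact K /\ K `<=` U]] }.

Definition unimodular : Prop :=
  forall mu, left_haar_measure mu ->
  forall (g : G) (A : set (borel G)), measurable A ->
    mu [set (x * g)%g | x in A] = mu A.
End haar.

HB.mixin Record isHilbert (R : realType) H of CompleteNormedModule R[i] H := {
  inner : {dot H for (@Num.conj R[i])};
  inner_normE : forall x : H, inner x x = `|x| ^+ 2 }.

#[short(type="hilbertType")]
HB.structure Definition Hilbert (R : realType) :=
  {H of isHilbert R H & CompleteNormedModule R[i] H}.

Section property_T.
Variables (R : realType) (G : topGroupType).

Record unitary_rep (H : hilbertType R) (rho : G -> H -> H) : Prop :=
  UnitaryRep {
    rep1 : forall x, rho 1%g x = x;
    repM : forall g h x, rho (g * h)%g x = rho g (rho h x);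
    rep_linear : forall g, linear (rho g);
    rep_inner : forall g x y, inner (rho g x) (rho g y) = inner x y;
    rep_continuous : forall x, continuous (fun g => rho g x) }.

(* As Q is compact and g |-> `|rho g x - x| is continuous, "the maximum over Q is
   at least kappa" says that some g in Q attains at least kappa. Norms on a
   complex space are valued in R[i], whence the injection of kappa. *)
Definition property_T : Prop :=
  exists (kappa : R) (Q : set G), [/\ 0 < kappa, compact Q &
    forall (H : hilbertType R) (rho : G -> H -> H), unitary_rep rho ->
      (exists2 x : H, x != 0 & forall g, rho g x = x) \/
      (forall x : H, `|x| = 1 ->
         exists2 g, Q g & (kappa%:C)%C <= `|rho g x - x|)].
End property_T.

Section action.
Variables (V : choiceType) (X : simplicial_complex V) (G : topGroupType).
Variable act : G -> V -> V.

Record automorphism_group : Prop := AutomorphismGroup {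
  act1 : forall v, act 1%g v = v;
  actM : forall g h v, act (g * h)%g v = act g (act h v);
  act_face : forall g s, face X s -> face X [fset act g v | v in s]%fset;
  act_faithful : forall g, (forall v, vertex X v -> act g v = v) -> g = 1%g }.

Definition cocompact : Prop :=
  exists S : set {fset V}, [/\ finite_set S, S `<=` face X &
    forall s, face X s -> exists g, exists2 t, S t & s = [fset act g v | v in t]%fset].

Definition stabilizer (s : {fset V}) : set G :=
  [set g | forall v, v \in s -> act g v = v].
End action.

Section weights.
Variables (R : realType) (V : choiceType) (X : simplicial_complex V).
Variables (n r : nat).

Record weight_function (G : topGroupType) (act : G -> V -> V)
    (m : seq V -> R) (C : nat -> R) : Prop := WeightFunction {
  weight_gt0 : forall k s, (r <= k)%N -> ordered_simplex X k s -> 0 < m s;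
  weight_act : forall k s g, (r <= k)%N -> ordered_simplex X k s ->
    m (map (act g) s) = m s;
  weight_perm : forall k s t, (r <= k)%N -> ordered_simplex X k s ->
    perm_eq s t -> m t = m s;
  weight_sum : forall k t, (r <= k <= n.-1)%N -> ordered_simplex X k t ->
    \sum_(s \in [set s | ordered_simplex X k.+1 s /\ {subset t <= s}]) m s =
    (k.+2)`!%:R * C k * m t }.

(* The least element of S, and 0 if there is none. *)
Definition minimum (S : set R) : R :=
  xget 0 [set x | S x /\ forall y, S y -> x <= y].

Variables (m : seq V -> R) (Ck : R).

Definition link_of (t : seq V) : simplicial_complex V :=
  link X [fset v in t]%fset.

(* For t of dimension k - 1, Ck is the constant C k of the weight function. *)
Definition link_laplacian (t : seq V) (f : V -> R) (u : V) : R :=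
  Ck * f u - (m (t ++ [:: u]))^-1 *
    \sum_(v \in [set v | ordered_simplex (link_of t) 1 [:: u; v]])
      m (t ++ [:: u; v]) * f v.

(* Functions on the vertices of the link are represented by functions on V of
   which only the values at these vertices matter. *)
Definition link_eigenvalue (t : seq V) (l : R) : Prop :=
  exists f : V -> R,
    (exists2 u, vertex (link_of t) u & f u != 0) /\
    (forall u, vertex (link_of t) u -> link_laplacian t f u = l * f u).

Definition lambda_link (t : seq V) : R :=
  minimum [set l | 0 < l /\ link_eigenvalue t l].

Definition lambda_min (k : nat) : R :=
  minimum [set lambda_link t | t in ordered_simplex X k.-1].
End weights.

(* Main.v *)
Require Import Defs.
From HB Require Import structures.
From mathcomp Require Import all_boot all_order all_algebra.
From mathcomp Require Import sesquilinear spectral finmap complex.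
From mathcomp Require Import all_classical all_reals all_analysis.
From mathcomp Require Import ring lra.

Set Implicit Arguments.
Unset Strict Implicit.
Unset Printing Implicit Defensive.

Import Order.TTheory GRing.Theory Num.Theory.
Import numFieldNormedType.Exports.

Local Open Scope classical_set_scope.
Local Open Scope ring_scope.

(** Equivariant functions f from the (k+1)-simplices to the representation space
    carry the energy E(f), the weighted sum over G-orbits of |f(s) - avg_t f|^2
    for the facets t of s, where avg_t f is the weighted mean of f over the
    simplices containing t.  Write g(s) for the sum of f(s) - avg_t f over the
    k+2 facets t of s.  Two distinct facets of s meet in a (k-1)-simplex t, and
    together they form an edge of its link: the spectral gap lam of the link,
    normalised by C k, bounds the sum of the cross terms in |g|^2 over the link
    below by -(1 - lam) times the diagonal terms.  Unimodularity makes sums over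
    incident pairs of simplices independent of the side on which they are taken,
    so that |g|^2 >= (1 - (k+1) (1 - lam)) E(f), with a positive constant exactly
    when lam > k/(k+1).

    Hence E decreases geometrically along f := f - g/(k+2).  The limit has energy
    zero, so it is constant along galleries, and its value is an invariant vector.
    If there is no nonzero invariant vector, this bounds |f| by a constant times
    the square root of E(f).  An almost invariant unit vector, moved to vectors
    fixed by the stabilizers and spread over X by equivariance, would give an f
    that is almost constant near finitely many orbit representatives, hence has
    small energy, but norm close to 1. *)

(** * Hilbert spaces *)

(** The map f -> g is self-adjoint for the inner product behind [sqnorm], its quadratic form is E,
    and it is bounded by k+2. The inequality |g|^2 >= c E(f) therefore says that it has no spectrum
    strictly between 0 and c. Iterating f - g/(k+2) reaches its kernel at an explicit rate, without
    a spectral theorem in infinite dimension. The space of equivariant functions is never built: its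
    inner products are finite sums over orbit representatives, and convergence is proved simplex by
    simplex.

    Eigenvalues enter only through the finite links, and there only for real functions. A real
    symmetric matrix acting on families of vectors of H is diagonalised over R[i] to pass from real
    functions to H-valued ones. The gap is carried in the form [0 <= l * (l - lam)], which admits l
    = 0 and negative l as well, so that positivity of the Laplacian never has to be shown.

    All constants come from the complex, the weights and the Haar measure, so that kappa and Q can
    be fixed before the representation is given. *)

Section real_inner_product.
Variables (R : realType) (H : hilbertType R).
Implicit Types (x y z : H) (a b : R).

(** Outside the diagonalisation of the links all coefficients are real, so [H] is treated as a real
    Hilbert space, with a norm in [R] instead of [R[i]]. *)
Definition rdot x y : R := complex.Re (inner x y).

Definition rscale a x : H := (a%:C)%C *: x.

Definition vnorm x : R := Num.sqrt (rdot x x).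

Lemma ReD (u v : R[i]) : complex.Re (u + v) = complex.Re u + complex.Re v.
Proof. by case: u => a b; case: v. Qed.

Lemma rdotDl x y z : rdot (x + y) z = rdot x z + rdot y z.
Proof. by rewrite /rdot linearDl ReD. Qed.

Lemma rdotC x y : rdot x y = rdot y x.
Proof.
rewrite /rdot hermC expr0 mul1r /=.
suff -> : ((inner y x)^*)%R = ((inner y x)^*)%C by case: (inner y x).
by [].
Qed.

Lemma rdotDr x y z : rdot z (x + y) = rdot z x + rdot z y.
Proof. by rewrite rdotC rdotDl !(rdotC z). Qed.

Lemma rdotZl a x y : rdot (rscale a x) y = a * rdot x y.
Proof.
rewrite /rdot /rscale linearZl_LR /=.
by case: (inner x y) => u v /=; rewrite mul0r subr0.
Qed.

Lemma rdotZr a x y : rdot x (rscale a y) = a * rdot x y.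
Proof. by rewrite rdotC rdotZl rdotC. Qed.

Lemma rdot0l x : rdot 0 x = 0.
Proof. by rewrite -(scale0r 0) -[0 *: _]/(rscale 0 0) rdotZl mul0r. Qed.

Lemma rdot0r x : rdot x 0 = 0.
Proof. by rewrite rdotC rdot0l. Qed.

Lemma rdotNl x y : rdot (- x) y = - rdot x y.
Proof. by apply/eqP; rewrite -addr_eq0 -rdotDl addNr rdot0l. Qed.

Lemma rdotNr x y : rdot x (- y) = - rdot x y.
Proof. by rewrite rdotC rdotNl rdotC. Qed.

Definition rdotE := (rdotDl, rdotDr, rdotNl, rdotNr, rdotZl, rdotZr).

Lemma rdot_suml (I : Type) (s : seq I) (P : pred I) (F : I -> H) y :
  rdot (\sum_(i <- s | P i) F i) y = \sum_(i <- s | P i) rdot (F i) y.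
Proof. by apply: (big_morph (rdot^~ y)) => [u v|]; rewrite ?rdotDl ?rdot0l. Qed.

Lemma rdot_sumr (I : Type) (s : seq I) (P : pred I) (F : I -> H) y :
  rdot y (\sum_(i <- s | P i) F i) = \sum_(i <- s | P i) rdot y (F i).
Proof. by apply: (big_morph (rdot y)) => [u v|]; rewrite ?rdotDr ?rdot0r. Qed.

Lemma rdot_ge0 x : 0 <= rdot x x.
Proof.
have : (0 : R[i]) <= inner x x by apply: dnorm_ge0.
by rewrite lecE => /andP[].
Qed.

Lemma rdotxxE x : inner x x = ((rdot x x)%:C)%C.
Proof.
have : (0 : R[i]) <= inner x x by apply: dnorm_ge0.
by rewrite /rdot; case: (inner x x) => u v; rewrite lecE /= => /andP[/eqP-> _].
Qed.

Lemma rdot_eq0 x : (rdot x x == 0) = (x == 0).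
Proof.
rewrite -(dnorm_eq0 (inner : {dot H for (@Num.conj R[i])})) rdotxxE.
by rewrite eq_complex /= eqxx andbT.
Qed.

Lemma vnorm_ge0 x : 0 <= vnorm x.
Proof. exact: sqrtr_ge0. Qed.

Lemma sqr_vnorm x : vnorm x ^+ 2 = rdot x x.
Proof. by rewrite sqr_sqrtr ?rdot_ge0. Qed.

Lemma vnormE x : `|x| = ((vnorm x)%:C)%C.
Proof.
apply/eqP; rewrite -(@eqrXn2 _ 2) ?normr_ge0 ?ler0c ?vnorm_ge0//.
by rewrite -inner_normE rdotxxE -rmorphXn /= sqr_vnorm.
Qed.

Lemma vnormD x y : vnorm (x + y) <= vnorm x + vnorm y.
Proof. by have := ler_normD x y; rewrite !vnormE -rmorphD lecR. Qed.

Lemma vnormN x : vnorm (- x) = vnorm x.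
Proof. by rewrite /vnorm !rdotE opprK. Qed.

Lemma vnormB x y : vnorm (x - y) = vnorm (y - x).
Proof. by rewrite -vnormN opprB. Qed.

Lemma vnorm_triangle z x y : vnorm (x - y) <= vnorm (x - z) + vnorm (z - y).
Proof. by apply: le_trans (vnormD _ _); rewrite addrA subrK. Qed.

Lemma vnorm0 : vnorm 0 = 0.
Proof. by rewrite /vnorm rdot0l sqrtr0. Qed.

Lemma vnorm_eq0 x : (vnorm x == 0) = (x == 0).
Proof. by rewrite sqrtr_eq0 -rdot_eq0 eq_le rdot_ge0 andbT. Qed.

Lemma vnormZ a x : vnorm (rscale a x) = `|a| * vnorm x.
Proof. by rewrite /vnorm !rdotE mulrA -expr2 sqrtrM ?sqr_ge0// sqrtr_sqr. Qed.

Lemma vnorm_sum (I : Type) (s : seq I) (P : pred I) (F : I -> H) :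
  vnorm (\sum_(i <- s | P i) F i) <= \sum_(i <- s | P i) vnorm (F i).
Proof.
elim/big_rec2 : _ => [|i u v _ le_uv]; first by rewrite vnorm0.
by apply: le_trans (vnormD _ _) _; rewrite lerD2l.
Qed.

Lemma rscaleDr a x y : rscale a (x + y) = rscale a x + rscale a y.
Proof. exact: scalerDr. Qed.

Lemma rscale_sumr (I : Type) (s : seq I) (P : pred I) (F : I -> H) a :
  rscale a (\sum_(i <- s | P i) F i) = \sum_(i <- s | P i) rscale a (F i).
Proof. exact: scaler_sumr. Qed.

Lemma rscaleA a b x : rscale a (rscale b x) = rscale (a * b) x.
Proof. by rewrite /rscale scalerA -rmorphM. Qed.

Lemma rscaleDl a b x : rscale (a + b) x = rscale a x + rscale b x.
Proof. by rewrite /rscale rmorphD scalerDl. Qed.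

Lemma rscaleN a x : rscale a (- x) = - rscale a x.
Proof. exact: scalerN. Qed.

Lemma rscale1 x : rscale 1 x = x.
Proof. exact: scale1r. Qed.

Lemma rscale0 x : rscale 0 x = 0.
Proof. exact: scale0r. Qed.

Definition tends (u : nat -> H) (l : H) :=
  forall e : R, 0 < e -> exists N, forall i, (N <= i)%N -> vnorm (u i - l) < e.

Lemma hilbert_complete (u : nat -> H) :
  (forall e : R, 0 < e -> exists N, forall i j, (N <= i)%N -> (N <= j)%N ->
     vnorm (u i - u j) < e) -> exists l, tends u l.
Proof.
move=> cu.
have cF : cauchy (u @ \oo).
  apply/cauchy_ballP => e; rewrite ltcE /= => /andP[/eqP e2 e0].
  have [N HN] := cu _ e0.
  exists ([set u i | i in [set i | (N <= i)%N]], [set u i | i in [set i | (N <= i)%N]]).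
    by split; exists N => // i /= Ni; exists i.
  move=> [x y] /= [[i Ni <-] [j Nj <-]]; rewrite -ball_normE /= vnormE ltcE /=.
  by rewrite -e2 eqxx HN.
have /cvg_ex[l ul] : cvg (u @ \oo) by exact: cauchy_cvg.
exists l => e e0.
have e0' : (0 : R[i]) < (e%:C)%C by rewrite ltcR.
move/cvgrPdist_lt : ul => /(_ _ e0') [N _ HN].
exists N => i Ni; have := HN i Ni.
by rewrite /= vnormE ltcR vnormB.
Qed.

End real_inner_product.

(** * Limits of sequences of vectors *)

Section limits.
Variables (R : realType) (H : hilbertType R).
Implicit Types (u v : nat -> H) (x y l : H).

Lemma tends_ext u v l : u =1 v -> tends u l -> tends v l.
Proof. by move=> uv ul e /ul[N HN]; exists N => i /HN; rewrite uv. Qed.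

Lemma tends_cst l : tends (fun=> l) l.
Proof. by move=> e e0; exists 0%N => i _; rewrite subrr vnorm0. Qed.

Lemma tendsD u v x y : tends u x -> tends v y -> tends (fun i => u i + v i) (x + y).
Proof.
move=> ux vy e e0; have e2 : 0 < e / 2 by rewrite divr_gt0.
have [N HN] := ux _ e2; have [N' HN'] := vy _ e2.
exists (maxn N N') => i; rewrite geq_max => /andP[/HN hu /HN' hv].
have -> : u i + v i - (x + y) = (u i - x) + (v i - y).
  by rewrite opprD addrACA.
by apply: (le_lt_trans (vnormD _ _)); lra.
Qed.

Lemma tendsZ a u x : tends u x -> tends (fun i => rscale a (u i)) (rscale a x).
Proof.
move=> ux e e0; have [N HN] := ux (e / (`|a| + 1)) ltac:(by rewrite divr_gt0// ltr_wpDl).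
exists N => i /HN; rewrite -[rscale a (u i) - _]/(_ *: _ - _ *: _) -scalerBr.
rewrite -[_ *: _]/(rscale a _) vnormZ ltr_pdivlMr ?ltr_wpDl// => h.
apply: le_lt_trans h; rewrite mulrC ler_wpM2l ?vnorm_ge0//.
by rewrite lerDl.
Qed.

Lemma tendsN u x : tends u x -> tends (fun i => - u i) (- x).
Proof.
move=> ux; suff -> : - x = rscale (- 1) x.
  by apply: tends_ext (tendsZ (-1) ux) => i; rewrite /rscale rmorphN scaleN1r.
by rewrite /rscale rmorphN scaleN1r.
Qed.

Lemma tends_sum (I : eqType) (s : seq I) (F : I -> nat -> H) (L : I -> H) :
  (forall i, i \in s -> tends (F i) (L i)) ->
  tends (fun j => \sum_(i <- s) F i j) (\sum_(i <- s) L i).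
Proof.
elim: s => [|i s ih] FL.
  by rewrite big_nil; apply: tends_ext (tends_cst 0) => j; rewrite big_nil.
rewrite big_cons; apply: tends_ext (tendsD (FL i (mem_head _ _)) (ih _)) => [j|j js].
  by rewrite big_cons.
by apply: FL; rewrite inE js orbT.
Qed.

Lemma tends_vnorm_le u l (b : R) :
  (forall i, vnorm (u i) <= b) -> tends u l -> vnorm l <= b.
Proof.
move=> ub ul; apply/ler_addgt0Pr => e /ul[N /(_ N (leqnn N))].
have := vnormD (u N) (l - u N); rewrite addrC subrK vnormB => h h'.
by have := ub N; lra.
Qed.

Lemma tends_unique u x y : tends u x -> tends u y -> x = y.
Proof.
move=> ux uy; apply/eqP; rewrite -subr_eq0 -vnorm_eq0 eq_le vnorm_ge0 andbT.
apply: (@tends_vnorm_le (fun i => u i - u i)).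
  by move=> i; rewrite subrr vnorm0.
exact: tendsD ux (tendsN uy).
Qed.

Lemma geometric_lt (c q e : R) : 0 <= q < 1 -> 0 < e ->
  exists N, forall i, (N <= i)%N -> c * q ^+ i < e.
Proof.
move=> /andP[q0 q1] e0.
have : (fun i => c * q ^+ i) @ \oo --> c * 0.
  by apply: cvgMr; apply: cvg_expr; rewrite ger0_norm.
rewrite mulr0 => /cvgrPdist_lt/(_ _ e0)[N _ HN]; exists N => i /HN /=.
by rewrite sub0r normrN => /(le_lt_trans (ler_norm _)).
Qed.

Lemma geometric_tends u (c q : R) : 0 <= c -> 0 <= q < 1 ->
  (forall i, vnorm (u i.+1 - u i) <= c * q ^+ i) ->
  exists2 l, tends u l & vnorm (u 0%N - l) <= c / (1 - q).
Proof.
move=> c0 q01 uc; have /andP[q0 q1] := q01.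
have q1' : 0 < 1 - q by rewrite subr_gt0.
(* The exact partial sum of the geometric series is what lets the induction on [d] close. *)
have step i d : vnorm (u (i + d)%N - u i) <= c / (1 - q) * (q ^+ i - q ^+ (i + d)).
  elim: d => [|d ih]; first by rewrite addn0 !subrr vnorm0 mulr0.
  rewrite addnS; apply: le_trans (vnorm_triangle (u (i + d)%N) _ _) _.
  apply: le_trans (lerD (uc _) ih) _.
  rewrite exprS le_eqVlt; apply/orP; left; apply/eqP.
  by field; rewrite gt_eqF.
have bnd i d : vnorm (u (i + d)%N - u i) <= c / (1 - q) * q ^+ i.
  apply: le_trans (step _ _) _; rewrite ler_wpM2l ?divr_ge0 ?(ltW q1')//.
  by rewrite lerBlDr lerDl exprn_ge0.
have [l ul] : exists l, tends u l.
  apply: hilbert_complete => e e0.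
  have [N HN] := geometric_lt (c / (1 - q)) q01 (ltac:(by rewrite divr_gt0) : 0 < e / 2).
  exists N => i j /subnKC <- /subnKC <-.
  apply: le_lt_trans (vnorm_triangle (u N) _ _) _.
  have := bnd N (i - N)%N; have := bnd N (j - N)%N; rewrite (vnormB (u N)).
  have := HN N (leqnn N); lra.
exists l => //; apply: (@tends_vnorm_le (fun i => u 0%N - u i)).
  by move=> i; rewrite vnormB; have := bnd 0%N i; rewrite add0n expr0 mulr1.
exact: tendsD (tends_cst _) (tendsN ul).
Qed.

End limits.

(** * Unitary representations and vectors fixed by a subgroup *)

Section unitary.
Variables (R : realType) (G : topGroupType) (H : hilbertType R).
Variables (rho : G -> H -> H) (rhoU : unitary_rep rho).
Implicit Types (x y : H) (g h : G).

Lemma repB g x y : rho g (x - y) = rho g x - rho g y.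
Proof.
by have /= := rep_linear rhoU g (-1) y x; rewrite !scaleN1r ![- _ + _]addrC.
Qed.

Lemma repD g x y : rho g (x + y) = rho g x + rho g y.
Proof. by have /= := rep_linear rhoU g 1 x y; rewrite !scale1r. Qed.

Lemma rep0 g : rho g 0 = 0.
Proof. by rewrite -{1}(subrr 0) repB subrr. Qed.

Lemma repZ g a x : rho g (rscale a x) = rscale a (rho g x).
Proof. by have /= := rep_linear rhoU g (a%:C)%C x 0; rewrite !addr0 rep0 addr0. Qed.

Lemma rep_sum g (I : Type) (s : seq I) (P : pred I) (F : I -> H) :
  rho g (\sum_(i <- s | P i) F i) = \sum_(i <- s | P i) rho g (F i).
Proof. by apply: (big_morph (rho g)) => [x y|]; rewrite ?repD ?rep0. Qed.

Lemma rep_rdot g x y : rdot (rho g x) (rho g y) = rdot x y.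
Proof. by rewrite /rdot (rep_inner rhoU). Qed.

Lemma rep_vnorm g x : vnorm (rho g x) = vnorm x.
Proof. by rewrite /vnorm rep_rdot. Qed.

Lemma rep_tends g u x : tends u x -> tends (fun i => rho g (u i)) (rho g x).
Proof. by move=> ux e /ux[N HN]; exists N => i /HN; rewrite -repB rep_vnorm. Qed.

(* The vector is the element of minimal norm of the convex K-invariant set of
   the y whose whole K-orbit stays within kappa of xi. *)
Lemma fixed_vector (K : set G) (kappa : R) (xi : H) :
  K 1%g -> (forall g h, K g -> K h -> K (g * h)%g) ->
  (forall g, K g -> vnorm (rho g xi - xi) <= kappa) ->
  exists2 eta, (forall g, K g -> rho g eta = eta) & vnorm (eta - xi) <= kappa.
Proof.
move=> K1 KM Kxi.
pose B := [set y | forall g, K g -> vnorm (rho g y - xi) <= kappa].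
pose D := [set rdot y y | y in B].
have Bxi : B xi by [].
have D0 : has_inf D.
  split; first by exists (rdot xi xi), xi.
  by exists 0 => _ [y _ <-]; exact: rdot_ge0.
set d := inf D.
have dB y : B y -> d <= rdot y y.
  by move=> By; apply: ge_inf; [exact: D0.2 | exists y].
have half z : rscale 2^-1 (z + z) = z :> H.
  by rewrite rscaleDr -rscaleDl (_ : 2^-1 + 2^-1 = 1) ?rscale1//; lra.
have Bmid y z : B y -> B z -> B (rscale 2^-1 (y + z)).
  move=> By Bz g Kg; rewrite repZ repD.
  have -> : rscale 2^-1 (rho g y + rho g z) - xi =
      rscale 2^-1 ((rho g y - xi) + (rho g z - xi)).
    by rewrite addrACA -opprD [RHS]rscaleDr rscaleN half.
  rewrite vnormZ ger0_norm ?invr_ge0// mulrC ler_pdivrMr//.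
  by apply: le_trans (vnormD _ _) _; have := By g Kg; have := Bz g Kg; lra.
(* Parallelogram identity, with the midpoint in [B]. It serves twice: for the Cauchy property of a
   minimising sequence and for the invariance of its limit. *)
have Bdist y z : B y -> B z ->
    rdot (y - z) (y - z) <= 2 * rdot y y + 2 * rdot z z - 4 * d.
  move=> By Bz; have := dB _ (Bmid y z By Bz); rewrite !rdotE (rdotC z y).
  by lra.
have Binv g y : K g -> B y -> B (rho g y).
  by move=> Kg By h Kh; rewrite -(repM rhoU); apply: By; apply: KM.
have [iv iv0 invN] : exists2 iv : nat -> R, (forall i, 0 < iv i) &
    forall e : R, 0 < e -> exists N, forall i, (N <= i)%N -> iv i < e.
  exists (fun i => i.+1%:R^-1) => [i|e e0]; first by rewrite invr_gt0.
  have [N HN] := ltr_add_invr e0.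
  exists N => i Ni; rewrite add0r in HN; apply: (le_lt_trans _ HN).
  by rewrite lef_pV2 ?posrE// ler_nat.
have /choice[y Hy] : forall i, exists y, B y /\ rdot y y < d + iv i.
  move=> i; have [_ [z Bz <-] hz] := inf_adherent (iv0 i) D0.
  by exists z.
have sq_lt (x : H) (e : R) : 0 < e -> rdot x x < e ^+ 2 -> vnorm x < e.
  by move=> e0; rewrite -sqr_vnorm ltr_pXn2r// nnegrE ?vnorm_ge0 ?ltW.
have [l yl] : exists l, tends y l.
  apply: hilbert_complete => e e0.
  have [N HN] := invN _ (ltac:(by rewrite divr_gt0 ?exprn_gt0) : 0 < e ^+ 2 / 4).
  exists N => i j Ni Nj; apply: sq_lt => //.
  have [Bi hi] := Hy i; have [Bj hj] := Hy j.
  by have := Bdist _ _ Bi Bj; have := HN i Ni; have := HN j Nj; lra.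
exists l => [g Kg|].
  (* [rho g (y i)] lies in [B] and has the norm of [y i]. Both being almost minimal, they are close,
     so [rho g (y i)] tends to [l] too. *)
  apply: (tends_unique (rep_tends g yl)) => e e0.
  have [N HN] := yl _ (ltac:(by rewrite divr_gt0) : 0 < e / 2).
  have [N' HN'] := invN _ (ltac:(by rewrite !(divr_gt0, exprn_gt0)) : 0 < (e/2) ^+ 2 / 4).
  exists (maxn N N') => i; rewrite geq_max => /andP[Ni N'i].
  apply: le_lt_trans (vnorm_triangle (y i) _ _) _.
  have [Bi hi] := Hy i.
  have : vnorm (rho g (y i) - y i) < e / 2.
    apply: sq_lt; first by rewrite divr_gt0.
    have := Bdist _ _ (Binv g _ Kg Bi) Bi; rewrite rep_rdot.
    by have := HN' i N'i; lra.
  by have := HN i Ni; lra.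
apply: (@tends_vnorm_le _ _ (fun i => y i - xi)).
  by move=> i; have [Bi _] := Hy i; have := Bi _ K1; rewrite (rep1 rhoU).
exact: tendsD yl (tends_cst _).
Qed.

End unitary.

(** * Spectral gap of a link *)

Section spectral_gap.
Variables (R : realType) (H : hilbertType R).
Local Open Scope sesquilinear_scope.

Lemma ReM_real (d : R) (z : R[i]) : complex.Re ((d%:C)%C * z) = d * complex.Re z.
Proof. by case: z => u v /=; rewrite mul0r subr0. Qed.

Lemma ImM_real (d : R) (z : R[i]) : complex.Im ((d%:C)%C * z) = d * complex.Im z.
Proof. by case: z => u v /=; rewrite mul0r addr0. Qed.

Lemma Re_sum (I : Type) (s : seq I) (F : I -> R[i]) :
  complex.Re (\sum_(i <- s) F i) = \sum_(i <- s) complex.Re (F i).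
Proof. by apply: (big_morph (@complex.Re R)) => [u v|//]; rewrite ReD. Qed.

Lemma Im_sum (I : Type) (s : seq I) (F : I -> R[i]) :
  complex.Im (\sum_(i <- s) F i) = \sum_(i <- s) complex.Im (F i).
Proof. by apply: (big_morph (@complex.Im R)) => [[u v] []|//]. Qed.

(** Expanding the left side leaves the entries of the conjugate transpose of [P] times [P], which is
    the identity. Two families are allowed because the quadratic form of a matrix pairs [a] with its
    image. *)
Lemma parseval N (P : 'M[R[i]]_N) (a c : 'I_N -> H) : P \is unitarymx ->
  \sum_i rdot (\sum_u P i u *: a u) (\sum_u P i u *: c u) =
  \sum_u rdot (a u) (c u).
Proof.
move=> PU.
have PP : P^t* *m P = 1%:M by rewrite -invmx_unitary// mulVmx// unitarymx_unit.
rewrite /rdot -!Re_sum; congr complex.Re.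
transitivity (\sum_i \sum_u \sum_v (P i u * (P i v)^*) * inner (a u) (c v)).
  apply: eq_bigr => i _; rewrite linear_sumlz; apply: eq_bigr => u _ /=.
  rewrite linearZl_LR/= linear_sumr mulr_sumr; apply: eq_bigr => v _ /=.
  by rewrite linearZr_LR/= mulrA.
rewrite exchange_big; apply: eq_bigr => u _ /=.
rewrite exchange_big (bigD1 u)//= [X in _ + X]big1 ?addr0 => [|v vu].
  rewrite -mulr_suml [X in X * _](_ : _ = (P^t* *m P) u u).
    by rewrite PP mxE eqxx mul1r.
  by rewrite mxE; apply: eq_bigr => i _; rewrite !mxE mulrC.
rewrite -mulr_suml [X in X * _](_ : _ = (P^t* *m P) v u).
  by rewrite PP mxE (negPf vu) mul0r.
by rewrite mxE; apply: eq_bigr => i _; rewrite !mxE mulrC.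
Qed.

(** The operator inequality lam S <= S^2 on families of vectors, checked eigenvalue by eigenvalue:
    the hypothesis says l^2 >= lam l for every eigenvalue with a real eigenvector. *)
Lemma spectral_gap_ord N (S : 'I_N -> 'I_N -> R) (lam : R) (a : 'I_N -> H) :
  (forall u v, S u v = S v u) ->
  (forall l (x : 'I_N -> R), (exists u, x u != 0) ->
     (forall u, \sum_v S u v * x v = l * x u) -> 0 <= l * (l - lam)) ->
  lam * (\sum_u rdot (a u) (\sum_v rscale (S u v) (a v))) <=
  \sum_u rdot (\sum_v rscale (S u v) (a v)) (\sum_v rscale (S u v) (a v)).
Proof.
move=> Ssym Sgap.
pose A : 'M[R[i]]_N := \matrix_(u, v) ((S u v)%:C)%C.
have Aherm : A \is hermsymmx.
  apply/is_hermitianmxP; rewrite expr0 scale1r; apply/matrixP => u v.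
  by rewrite !mxE Ssym; apply: esym; exact: conjc_real.
pose P := spectralmx A; pose D := spectral_diag A.
have PU : P \is unitarymx := spectral_unitarymx A.
have PA : P *m A = diag_mx D *m P.
  have /hermitian_normalmx/orthomx_spectralP -> := Aherm.
  by rewrite !mulmxA mulmxV ?mul1mx ?unitarymx_unit.
pose d i := complex.Re (D 0 i).
have Dd i : D 0 i = ((d i)%:C)%C.
  have /mxOverP/(_ 0 i) := hermitian_spectral_diag_real Aherm.
  by move=> /RRe_real.
have eigP i u : \sum_v ((S u v)%:C)%C * P i v = ((d i)%:C)%C * P i u.
  move/matrixP : PA => /(_ i u); rewrite mul_diag_mx !mxE Dd => <-.
  by apply: eq_bigr => v _; rewrite !mxE Ssym mulrC.
have gapd i : 0 <= d i * (d i - lam).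
  have [u Pu] : exists u, P i u != 0.
    apply: contrapT => /forallNP Pi0.
    have /unitarymxP/matrixP/(_ i i) := PU; rewrite !mxE eqxx big1 => [/eqP|u _].
      by rewrite eq_sym oner_eq0.
    by have /negP/negPn/eqP -> := Pi0 u; rewrite mul0r.
  (* The rows of [P] are complex eigenvectors, whereas the hypothesis speaks of real ones. As [S]
     and [d i] are real, the nonzero one of the real and imaginary parts is again an eigenvector. *)
  have : (complex.Re (P i u) != 0) || (complex.Im (P i u) != 0).
    by move: Pu; rewrite eq_complex negb_and.
  move=> /orP[Pu'|Pu'].
    apply: (Sgap (d i) (fun v => complex.Re (P i v))); first by exists u.
    move=> v; rewrite -ReM_real -eigP Re_sum.
    by apply: eq_bigr => w _; rewrite ReM_real.
  apply: (Sgap (d i) (fun v => complex.Im (P i v))); first by exists u.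
  move=> v; rewrite -ImM_real -eigP Im_sum.
  by apply: eq_bigr => w _; rewrite ImM_real.
pose b i := \sum_u P i u *: a u.
pose Sa u := \sum_v rscale (S u v) (a v).
have PSa i : \sum_u P i u *: Sa u = rscale (d i) (b i).
  rewrite /rscale scaler_sumr; under eq_bigr do rewrite scaler_sumr.
  rewrite exchange_big; apply: eq_bigr => u _ /=.
  rewrite scalerA -eigP scaler_suml; apply: eq_bigr => v _.
  by rewrite /rscale scalerA Ssym mulrC.
have := parseval a Sa PU; have := parseval Sa Sa PU; rewrite /Sa => <- <-.
rewrite mulr_sumr; apply: ler_sum => i _.
rewrite PSa -/(b i) !rdotE -subr_ge0.
have -> : d i * (d i * rdot (b i) (b i)) - lam * (d i * rdot (b i) (b i)) =
  d i * (d i - lam) * rdot (b i) (b i) by ring.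
by rewrite mulr_ge0// rdot_ge0.
Qed.

Lemma spectral_gap (I : finType) (S : I -> I -> R) (lam : R) (a : I -> H) :
  (forall u v, S u v = S v u) ->
  (forall l (x : I -> R), (exists u, x u != 0) ->
     (forall u, \sum_v S u v * x v = l * x u) -> 0 <= l * (l - lam)) ->
  lam * (\sum_u rdot (a u) (\sum_v rscale (S u v) (a v))) <=
  \sum_u rdot (\sum_v rscale (S u v) (a v)) (\sum_v rscale (S u v) (a v)).
Proof.
move=> Ssym Sgap; pose ev := @enum_val I I.
have rI (T : nmodType) (F : I -> T) : \sum_u F u = \sum_i F (ev i).
  by rewrite (reindex ev)//; apply: onW_bij; exact: enum_val_bij.
rewrite !rI; under eq_bigr do rewrite rI.
under [X in _ <= X]eq_bigr do rewrite rI.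
apply: (@spectral_gap_ord _ (fun i j => S (ev i) (ev j)) lam (fun i => a (ev i))).
  by move=> u v; exact: Ssym.
move=> l x [u xu] xe; apply: (Sgap l (fun v => x (enum_rank v))).
  by exists (ev u); rewrite enum_valK.
move=> v; rewrite rI -[v]enum_rankK -/(ev _) enum_valK -xe.
by apply: eq_bigr => j _; rewrite enum_valK.
Qed.

End spectral_gap.

(** * Edge functions on a weighted graph with a spectral gap *)

Section local_inequality.
Variables (R : realType) (H : hilbertType R) (I : finType).
Variables (m : I -> I -> R) (lam : R).
Let d u := \sum_v m u v.
Hypothesis m_sym : forall u v, m u v = m v u.
Hypothesis m_ge0 : forall u v, 0 <= m u v.
Hypothesis d_gt0 : forall u, 0 < d u.
Hypothesis lam_lt2 : lam < 2.
Hypothesis gap : forall (l : R) (f : I -> R), (exists u, f u != 0) ->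
  (forall u, f u - (d u)^-1 * \sum_v m u v * f v = l * f u) -> 0 <= l * (l - lam).

Let avg (F : I -> I -> H) u := rscale (d u)^-1 (\sum_v rscale (m u v) (F u v)).

Let avgE F u : rscale (d u) (avg F u) = \sum_v rscale (m u v) (F u v).
Proof. by rewrite rscaleA divff ?rscale1// gt_eqF. Qed.

(** The map from [a] to [a - b] is self-adjoint only for the inner product weighted by [d].
    Conjugation by the square root [s] of [d] turns it into the symmetric matrix [S], and dividing
    by [s] turns eigenvectors of [S] into those of [gap]. *)
Lemma laplacian_gap (a : I -> H) (b := avg (fun _ v => a v)) :
  lam * (\sum_u d u * rdot (a u) (a u - b u)) <=
  \sum_u d u * rdot (a u - b u) (a u - b u).
Proof.
pose s u := Num.sqrt (d u).
have s0 u : s u != 0 by rewrite sqrtr_eq0 -ltNge.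
have ss u : s u * s u = d u by rewrite -expr2 sqr_sqrtr ?ltW.
pose S u v : R := (u == v)%:R - (s u)^-1 * m u v * (s v)^-1.
have Sx (x : I -> R) u : \sum_v S u v * x v =
    x u - (s u)^-1 * \sum_v m u v * ((s v)^-1 * x v).
  rewrite /S; under eq_bigr do rewrite mulrBl.
  rewrite sumrB mulr_sumr; congr (_ - _); last first.
    by apply: eq_bigr => v _; rewrite !mulrA.
  rewrite (bigD1 u)//= eqxx mul1r big1 ?addr0// => v vu.
  by rewrite eq_sym (negPf vu) mul0r.
have Sb u : \sum_v rscale (S u v) (rscale (s v) (a v)) = rscale (s u) (a u - b u).
  under eq_bigr do rewrite rscaleA mulrBl rscaleDl.
  rewrite big_split/= (bigD1 u)//= eqxx mul1r.
  rewrite [X in _ + X + _]big1 ?addr0 => [|v vu]; last first.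
    by rewrite eq_sym (negPf vu) mul0r rscale0.
  rewrite rscaleDr rscaleN; congr (_ + _).
  rewrite /b /avg rscaleA -ss invfM mulrA divff// mul1r rscale_sumr -sumrN.
  apply: eq_bigr => v _; rewrite rscaleA divfK//.
  by rewrite /rscale rmorphN scaleNr.
have := @spectral_gap R H I S lam (fun u => rscale (s u) (a u)).
have -> : \sum_u rdot (rscale (s u) (a u)) (\sum_v rscale (S u v) (rscale (s v) (a v)))
    = \sum_u d u * rdot (a u) (a u - b u).
  by apply: eq_bigr => u _; rewrite Sb rdotZl rdotZr mulrA ss.
have -> : \sum_u rdot (\sum_v rscale (S u v) (rscale (s v) (a v)))
     (\sum_v rscale (S u v) (rscale (s v) (a v)))
    = \sum_u d u * rdot (a u - b u) (a u - b u).
  by apply: eq_bigr => u _; rewrite Sb rdotZl rdotZr mulrA ss.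
apply=> [u v|l x [u xu] xe].
  by rewrite /S eq_sym m_sym; congr (_ - _); ring.
apply: (gap (f := fun v => (s v)^-1 * x v)).
  by exists u; rewrite mulf_neq0 ?invr_eq0.
by move=> v; rewrite mulrCA -xe Sx mulrBr -ss invfM mulrA.
Qed.

(* Let A be the averaging operator and a the vertex average of the edge function
   F.  The defect of the inequality is read off from |w - y|^2 >= 0 for
   w = F u v - a u and y = t (a v - (A a) u), with the optimal t = 1 / (2 - lam). *)
Lemma local_inequality (F : I -> I -> H) (a := avg F) :
  (forall u v, m u v != 0 -> F u v = F v u) ->
  0 <= \sum_u \sum_v m u v * (rdot (F u v - a u) (F u v - a v) +
                        (1 - lam) * rdot (F u v - a u) (F u v - a u)).
Proof.
move=> F_sym; pose b := avg (fun _ v => a v).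
pose L (f : I -> I -> R) := \sum_u \sum_v m u v * f u v.
have LD f g : L (fun u v => f u v + g u v) = L f + L g.
  rewrite -big_split; apply: eq_bigr => u _; rewrite -big_split.
  by apply: eq_bigr => v _; rewrite mulrDr.
have LZ c f : L (fun u v => c * f u v) = c * L f.
  rewrite mulr_sumr; apply: eq_bigr => u _; rewrite mulr_sumr.
  by apply: eq_bigr => v _; rewrite mulrCA.
have eqL f g : (forall u v, f u v = g u v) -> L f = L g.
  by move=> fg; apply: eq_bigr => u _; apply: eq_bigr => v _; rewrite fg.
have Lsym f : L f = L (fun u v => f v u).
  rewrite /L exchange_big; apply: eq_bigr => u _; apply: eq_bigr => v _ /=.
  by rewrite m_sym.
have Lavg G (c : I -> H) : L (fun u v => rdot (G u v) (c u)) =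
    \sum_u d u * rdot (avg G u) (c u).
  apply: eq_bigr => u _; rewrite -rdotZl avgE rdot_suml.
  by apply: eq_bigr => v _; rewrite rdotZl.
have Lfst (f : I -> R) : L (fun u v => f u) = \sum_u d u * f u.
  by apply: eq_bigr => u _; rewrite -mulr_suml.
pose FF := L (fun u v => rdot (F u v) (F u v)).
pose AA := \sum_u d u * rdot (a u) (a u).
pose BB := \sum_u d u * rdot (b u) (b u).
pose X := \sum_u d u * rdot (a u) (b u).
have LFa : L (fun u v => rdot (F u v) (a u)) = AA by rewrite Lavg.
have LFa' : L (fun u v => rdot (F u v) (a v)) = AA.
  rewrite -LFa Lsym /L; apply: eq_bigr => u _; apply: eq_bigr => v _.
  have [->|/F_sym ->//] := eqVneq (m u v) 0; by rewrite !mul0r.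
have LFb : L (fun u v => rdot (F u v) (b u)) = X by rewrite Lavg.
have Lab : L (fun u v => rdot (a v) (b u)) = BB by rewrite (Lavg (fun _ v => a v)).
have Laa : L (fun u v => rdot (a u) (a u)) = AA by rewrite Lfst.
have Laa' : L (fun u v => rdot (a v) (a v)) = AA by rewrite Lsym Lfst.
have Lbb : L (fun u v => rdot (b u) (b u)) = BB by rewrite Lfst.
have Lab' : L (fun u v => rdot (a u) (b u)) = X by rewrite Lfst.
have LX : L (fun u v => rdot (a u) (a v)) = X.
  rewrite (eqL _ (fun u v => rdot (a v) (a u))) => [|u v]; last by rewrite rdotC.
  by rewrite (Lavg (fun _ v => a v)); apply: eq_bigr => u _; rewrite rdotC.
have lg : lam * (\sum_u d u * rdot (a u) (a u - b u)) <=
    \sum_u d u * rdot (a u - b u) (a u - b u) := laplacian_gap a.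
clearbody b; clearbody a.
have gap_ab : lam * (AA - X) <= AA - 2 * X + BB.
  move: lg.
  have -> : \sum_u d u * rdot (a u) (a u - b u) = AA - X.
    by rewrite -sumrB; apply: eq_bigr => u _; rewrite !rdotE -mulrBr.
  have -> // : \sum_u d u * rdot (a u - b u) (a u - b u) = AA - 2 * X + BB.
  rewrite mulr_sumr -sumrB -big_split; apply: eq_bigr => u _ /=.
  by rewrite !rdotE (rdotC (b u) (a u)); ring.
pose t := (2 - lam)^-1.
have t0 : 0 < t by rewrite invr_gt0 subr_gt0.
have test : 0 <= FF - AA - 2 * t * (AA - X) + t ^+ 2 * (AA - BB).
  have -> : FF - AA - 2 * t * (AA - X) + t ^+ 2 * (AA - BB) =
      L (fun u v => rdot (F u v - a u - rscale t (a v - b u))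
                         (F u v - a u - rscale t (a v - b u))).
    rewrite (eqL _ (fun u v => rdot (F u v) (F u v) + (-2 * rdot (F u v) (a u) +
       (rdot (a u) (a u) + (-2 * t * rdot (F u v) (a v) + (2 * t * rdot (F u v) (b u)
       + (2 * t * rdot (a u) (a v) + (- 2 * t * rdot (a u) (b u) +
       (t ^+ 2 * rdot (a v) (a v) + (- 2 * t ^+ 2 * rdot (a v) (b u) +
        t ^+ 2 * rdot (b u) (b u))))))))))) => [|u v].
      do 9 rewrite LD; rewrite !LZ -/FF LFa LFa' LFb Lab Laa Laa' Lbb Lab' LX; ring.
    rewrite !rdotE (rdotC (a u) (F u v)) (rdotC (a v) (F u v)) (rdotC (b u) (F u v)).
    by rewrite (rdotC (a v) (a u)) (rdotC (b u) (a u)) (rdotC (b u) (a v)); ring.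
  apply: sumr_ge0 => u _; apply: sumr_ge0 => v _.
  by rewrite mulr_ge0// rdot_ge0.
have tlam : t * (2 - lam) = 1 by rewrite mulVf// gt_eqF// subr_gt0.
(* In these terms the claim reads (2 - lam) (FF - AA) >= AA - X. *)
have -> : \sum_u \sum_v m u v * (rdot (F u v - a u) (F u v - a v) +
    (1 - lam) * rdot (F u v - a u) (F u v - a u)) =
    (2 - lam) * (FF - AA) - (AA - X).
  rewrite -/(L (fun u v => rdot (F u v - a u) (F u v - a v) +
    (1 - lam) * rdot (F u v - a u) (F u v - a u))).
  rewrite (eqL _ (fun u v => (2 - lam) * rdot (F u v) (F u v) +
    ((- (1 + 2 * (1 - lam))) * rdot (F u v) (a u) + ((- 1) * rdot (F u v) (a v) +
    (rdot (a u) (a v) + (1 - lam) * rdot (a u) (a u)))))) => [|u v].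
    by do 4 rewrite LD; rewrite !LZ -/FF LFa LFa' Laa LX; ring.
  by rewrite !rdotE (rdotC (a u) (F u v)); ring.
(* [gap_ab] is equivalent to AA - BB <= (2 - lam) (AA - X), and t (2 - lam) = 1. Inserted in [test],
   this absorbs one of the two copies of t (AA - X). *)
have h1 : t ^+ 2 * (AA - BB) <= t * (AA - X).
  rewrite expr2 -mulrA ler_wpM2l ?(ltW t0)//.
  suff : t * (AA - BB) <= t * ((2 - lam) * (AA - X)).
    by rewrite mulrA tlam mul1r.
  by rewrite ler_wpM2l ?(ltW t0)//; lra.
have h2 : t * (AA - X) <= FF - AA by lra.
have : (2 - lam) * (t * (AA - X)) <= (2 - lam) * (FF - AA).
  by rewrite ler_wpM2l// subr_ge0 ltW.
by rewrite mulrA [_ * t]mulrC tlam mul1r subr_ge0.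
Qed.

End local_inequality.

(** * Counting simplices and orbits *)

Section double_counting.
Variables (V : choiceType) (T : nmodType).
Implicit Types (s t : {fset V}) (x y : V).
Local Open Scope fset_scope.

Definition subs p s : {fset {fset V}} := [fset t in fpowerset s | #|` t| == p].

Lemma in_subs p s t : (t \in subs p s) = (t `<=` s) && (#|` t| == p).
Proof. by rewrite !inE /= fpowersetE. Qed.

Lemma subs_card s : subs #|` s| s = [fset s].
Proof.
apply/fsetP => t; rewrite in_subs inE; apply/andP/eqP => [[ts /eqP cts]|->].
  by apply/eqP; rewrite eqEfcard ts cts leqnn.
by rewrite eqxx fsubset_refl.
Qed.

Lemma sum_subs_diff p s (F : V -> {fset V} -> T) :
  (\sum_(t <- subs p s) \sum_(x <- s `\` t) F x t =
   \sum_(x <- s) \sum_(t <- subs p (s `\ x)) F x t)%R.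
Proof.
transitivity (\sum_(t <- subs p s) \sum_(x <- s | x \notin t) F x t)%R.
  apply: eq_big_seq => t _; rewrite [RHS]big_fset_condE.
  by apply: eq_fbigl => x; rewrite !inE /= andbC.
rewrite (exchange_big_dep xpredT)//=; apply: eq_big_seq => x xs.
rewrite [LHS]big_fset_condE; apply: eq_fbigl => t.
rewrite !inE /= !fpowersetE fsubsetD1.
by rewrite -andbA -andbA; congr (_ && _); rewrite andbC.
Qed.

Lemma sum_facets s (F : {fset V} -> T) p : #|` s| = p.+1 ->
  (\sum_(t <- subs p s) F t = \sum_(x <- s) F (s `\ x))%R.
Proof.
move=> sp; have cD x : x \in s -> #|` s `\ x| = p.
  by move=> xs; have := cardfsD1 x s; rewrite xs sp add1n => -[].
transitivity (\sum_(t <- subs p s) \sum_(x <- s `\` t) F t)%R.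
  apply: eq_big_seq => t; rewrite in_subs => /andP[ts /eqP tp].
  have : #|` s `\` t| == 1%N by rewrite cardfsDS// sp tp subSnn.
  by move=> /cardfs1P[x ->]; rewrite big_seq_fset1.
rewrite sum_subs_diff; apply: eq_big_seq => x xs.
by rewrite -(cD x xs) subs_card big_seq_fset1.
Qed.

(** A face of codimension two with an ordering of its two missing vertices is the same as an ordered
    pair of distinct vertices, hence of distinct facets. This is how pairs of facets get sorted by
    the link in which they form an edge. *)
Lemma sum_codim2 p s (F : V -> V -> T) : #|` s| = p.+2 ->
  (\sum_(t <- subs p s) \sum_(x <- s `\` t) \sum_(y <- s `\` (x |` t)) F x y =
   \sum_(x <- s) \sum_(y <- s `\ x) F x y)%R.
Proof.
move=> sp; rewrite (@sum_subs_diff p s (fun x t => \sum_(y <- s `\` (x |` t)) F x y)%R).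
apply: eq_big_seq => x xs.
have sx : #|` s `\ x| = p.+1 by have := cardfsD1 x s; rewrite xs sp add1n => -[].
under eq_bigr do rewrite -fsetDDl.
rewrite (@sum_subs_diff p _ (fun y t => F x y)); apply: eq_big_seq => y ysx.
have sxy : #|` (s `\ x) `\ y| = p.
  by have := cardfsD1 y (s `\ x); rewrite ysx sx add1n => -[].
by rewrite -{1}sxy subs_card big_seq_fset1.
Qed.

Lemma exists_fsubset s p : (p <= #|` s|)%N -> exists2 t, t `<=` s & #|` t| = p.
Proof.
move=> ps; exists [fset x in take p s].
  by apply/fsubsetP => x; rewrite !inE => /mem_take.
rewrite card_fseq undup_id ?take_uniq//.
by rewrite size_takel.
Qed.

End double_counting.

(** * Stars and links as finite sets *)

Section stars.
Variables (V : choiceType) (X : simplicial_complex V) (r : nat).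
Hypothesis links_finite :
  forall s, face X s -> #|` s| = r.+1 -> finite_set (face (link X s)).
Implicit Types (s t : {fset V}) (x y : V).

(** [q] counts vertices. [fset_set] is empty on an infinite set, so membership is meaningful only
    once finiteness is known, here for faces with at least [r + 1] vertices. *)
Definition star q t : {fset {fset V}} :=
  fset_set [set s | [/\ face X s, (t `<=` s)%fset & #|` s| = q]].

Definition nbr t : {fset V} :=
  fset_set [set x | x \notin t /\ face X (x |` t)%fset].

(** A face of [t] with [r + 1] vertices has a finite link, and a simplex containing it is determined
    by its remaining vertices. These form a face of the link or, when there are none, the empty set,
    which is not a face and is added by hand. *)
Lemma finite_star t : face X t -> (r.+1 <= #|` t|)%N ->
  finite_set [set s | face X s /\ (t `<=` s)%fset].
Proof.
move=> Xt rt; have [t' t't ct'] := exists_fsubset rt.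
have t'0 : t' != fset0 by rewrite -cardfs_gt0 ct'.
have Xt' : face X t' by apply: face_sub Xt _ t'0.
apply: (@sub_finite_set _ _ [set (t' `|` u)%fset | u in face (link X t') `|` [set fset0]]).
  move=> s [Xs ts]; exists (s `\` t')%fset; last first.
    by rewrite fsetUDl fsetDv fsetD0 (fsetUidPr _ _ _)// (fsubset_trans t't).
  have [->|s0] := eqVneq (s `\` t')%fset fset0; [by right|left].
  split => //; first by apply/fdisjointP => x xt; rewrite inE xt.
  by rewrite fsetUDl fsetDv fsetD0 (fsetUidPr _ _ _)// (fsubset_trans t't).
by apply: finite_image; rewrite finite_setU; split; [exact: links_finite|].
Qed.

Lemma in_star q t s : face X t -> (r.+1 <= #|` t|)%N ->
  s \in star q t <-> [/\ face X s, (t `<=` s)%fset & #|` s| = q].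
Proof.
move=> Xt rt; rewrite in_fset_set ?inE; last first.
  by apply: sub_finite_set (finite_star Xt rt) => u [].
by split.
Qed.

Lemma in_nbr t x : face X t -> (r.+1 <= #|` t|)%N ->
  x \in nbr t <-> x \notin t /\ face X (x |` t)%fset.
Proof.
move=> Xt rt; rewrite in_fset_set ?inE; last first.
  apply: (@sub_finite_set _ _ (\bigcup_(s in [set s | face X s /\ (t `<=` s)%fset])
     [set` s])).
    move=> y [yt Xy]; exists (y |` t)%fset; first by split=> //; rewrite fsubsetU1.
    by rewrite /= !inE eqxx.
  by apply: bigcup_finite => [|s _]; [exact: finite_star | exact: finite_fset].
by split.
Qed.

Lemma sum_star_nbr (T : nmodType) t (F : {fset V} -> T) :
  face X t -> (r.+1 <= #|` t|)%N ->
  \sum_(s <- star #|` t|.+1 t) F s = \sum_(x <- nbr t) F (x |` t)%fset.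
Proof.
move=> Xt rt.
have -> : star #|` t|.+1 t = [fset (x |` t)%fset | x in nbr t]%fset.
  apply/fsetP => s; apply/idP/imfsetP => [|[x /= /in_nbr[]// xt Xx ->]].
    move=> /in_star[]// Xs ts cs.
    have : #|` (s `\` t)%fset| == 1%N by rewrite cardfsDS// cs subSnn.
    move=> /cardfs1P[x sx]; exists x.
      have xst : x \in (s `\` t)%fset by rewrite sx inE.
      apply/in_nbr => //; move: xst; rewrite inE => /andP[xt xs]; split=> //.
      by rewrite -sx fsetUC fsetUDl fsetDv fsetD0 (fsetUidPr _ _ _).
    by rewrite /= -sx fsetUC fsetUDl fsetDv fsetD0 (fsetUidPr _ _ _).
  by apply/in_star => //; rewrite fsubsetU1 cardfsU1 xt add1n; split.
rewrite big_imfset//= => x y /in_nbr[]// xt _ /in_nbr[]// yt _ /fsetP/(_ x).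
by rewrite !inE eqxx (negPf xt) !orbF => /esym/eqP.
Qed.

Lemma sum_star_diff (T : nmodType) q t (F : {fset V} -> V -> T) :
  face X t -> (r.+1 <= #|` t|)%N ->
  \sum_(s <- star q t) \sum_(x <- (s `\` t)%fset) F s x =
  \sum_(x <- nbr t) \sum_(s <- star q (x |` t)%fset) F s x.
Proof.
move=> Xt rt.
transitivity (\sum_(s <- star q t) \sum_(x <- nbr t | x \in s) F s x).
  apply: eq_big_seq => s /in_star[]// Xs ts cs; rewrite [RHS]big_fset_condE.
  apply: eq_fbigl => x; apply/idP/idP => /=.
    rewrite !inE /= => /andP[xt xs]; rewrite xs andbT.
    apply/in_nbr => //; split=> //; apply: face_sub Xs _ _.
      by apply/fsubsetP => y; rewrite !inE => /orP[/eqP->//|]; exact/fsubsetP.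
    by apply/fset0Pn; exists x; rewrite !inE eqxx.
  by rewrite !inE /= => /andP[/in_nbr[]// -> _ ->].
rewrite (exchange_big_dep xpredT)//=; apply: eq_big_seq => x /in_nbr[]// xt Xx.
have rx : (r.+1 <= #|` (x |` t)%fset|)%N by rewrite cardfsU1 xt ltnW.
rewrite [LHS]big_fset_condE; apply: eq_fbigl => s; apply/idP/idP => /=.
  rewrite !inE /= => /andP[/in_star[]// Xs ts cs xs]; apply/in_star => //; split=> //.
  by rewrite fsubUset ts fsub1set xs.
move=> /in_star[]// Xs; rewrite fsubUset fsub1set => /andP[xs ts] cs.
by rewrite !inE /= xs andbT; apply/in_star.
Qed.

Lemma sum_star_pairs (T : nmodType) t (F : {fset V} -> V -> V -> T) :
  face X t -> (r.+1 <= #|` t|)%N ->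
  \sum_(s <- star #|` t|.+2 t) \sum_(x <- (s `\` t)%fset)
      \sum_(y <- (s `\` (x |` t))%fset) F s x y =
  \sum_(x <- nbr t) \sum_(y <- nbr (x |` t)%fset) F (y |` (x |` t))%fset x y.
Proof.
move=> Xt rt.
rewrite (@sum_star_diff _ _ t (fun s x => \sum_(y <- (s `\` (x |` t))%fset) F s x y))//.
apply: eq_big_seq => x /in_nbr[]// xt Xx.
have cx : #|` (x |` t)%fset| = #|` t|.+1 by rewrite cardfsU1 xt add1n.
have rx : (r.+1 <= #|` (x |` t)%fset|)%N by rewrite cx ltnW.
rewrite -cx sum_star_nbr//; apply: eq_big_seq => y /in_nbr[]// yxt _.
have -> : ((y |` (x |` t)) `\` (x |` t) = [fset y])%fset.
  apply/fsetP => z; move: yxt; rewrite !inE; case: (eqVneq z y) => [->|_] /=.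
    by move=> ->.
  by rewrite andNb.
by rewrite big_seq_fset1.
Qed.

End stars.

(** * The action on simplices and orbit representatives *)

Section simplex_action.
Variables (V : choiceType) (X : simplicial_complex V) (G : topGroupType).
Variable act : G -> V -> V.
Hypothesis G_aut : automorphism_group X act.
Implicit Types (s t : {fset V}) (g h : G).

Definition gact g s : {fset V} := [fset act g v | v in s]%fset.

(** With [t = s] this is the setwise stabilizer, in contrast to the pointwise [stabilizer]. *)
Definition transporter s t : set G := [set g | gact g s = t].

(** The choice is made from the orbit as a set, so it depends on the orbit only. The default is
    never taken, since [s] lies in its orbit. *)
Definition orbit_rep s := xget fset0 [set t | exists g, gact g s = t].

Lemma act_inv g v : act g^-1%g (act g v) = v.
Proof. by rewrite -(actM G_aut) mulVg (act1 G_aut). Qed.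

Lemma act_inj g : injective (act g).
Proof. exact: can_inj (act_inv g). Qed.

Lemma gact1 s : gact 1%g s = s.
Proof.
apply/fsetP => v; apply/imfsetP/idP => /= [[u us ->]|vs].
  by rewrite (act1 G_aut).
by exists v; rewrite ?(act1 G_aut).
Qed.

Lemma gactM g h s : gact (g * h)%g s = gact g (gact h s).
Proof.
apply/fsetP => v; apply/imfsetP/imfsetP => /= [[u us ->]|[_ /imfsetP[u /= us ->] ->]].
  by exists (act h u); rewrite ?(actM G_aut)//; apply/imfsetP; exists u.
by exists u; rewrite ?(actM G_aut).
Qed.

Lemma gactK g s : gact g^-1%g (gact g s) = s.
Proof. by rewrite -gactM mulVg gact1. Qed.

Lemma gactKV g s : gact g (gact g^-1%g s) = s.
Proof. by rewrite -gactM mulgV gact1. Qed.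

Lemma mem_gact g s v : (act g v \in gact g s) = (v \in s).
Proof. by rewrite mem_imfset//=; exact: act_inj. Qed.

Lemma card_gact g s : #|` gact g s| = #|` s|.
Proof. by rewrite card_imfset//=; exact: act_inj. Qed.

Lemma gactS g s t : (gact g s `<=` gact g t)%fset = (s `<=` t)%fset.
Proof.
apply/fsubsetP/fsubsetP => st v.
  by rewrite -(mem_gact g) => /st; rewrite mem_gact.
by move=> /imfsetP[u /= us ->]; rewrite mem_gact; exact: st.
Qed.

Lemma face_gact g s : face X (gact g s) <-> face X s.
Proof.
split; last exact: (act_face G_aut).
by move=> /(act_face G_aut g^-1%g); rewrite -/(gact _ _) gactK.
Qed.

Lemma actKV g v : act g (act g^-1%g v) = v.
Proof. by rewrite -(actM G_aut) mulgV (act1 G_aut). Qed.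

Lemma gactD g s t : gact g (s `\` t)%fset = (gact g s `\` gact g t)%fset.
Proof.
by apply/fsetP => v; rewrite -(actKV g v) inE !mem_gact inE.
Qed.

Lemma gactU1 g v s : gact g (v |` s)%fset = (act g v |` gact g s)%fset.
Proof.
apply/fsetP => u.
by rewrite -(actKV g u) !inE !mem_gact !inE (inj_eq (@act_inj g)).
Qed.

Lemma gactD1 g s v : gact g (s `\ v)%fset = (gact g s `\ act g v)%fset.
Proof.
apply/fsetP => u.
by rewrite -(actKV g u) mem_gact !inE mem_gact (inj_eq (@act_inj g)).
Qed.

Lemma orbit_repP s : exists g, gact g s = orbit_rep s.
Proof.
apply: (@xgetPex _ fset0 [set t | exists g, gact g s = t]).
by exists s, 1%g; rewrite gact1.
Qed.

Lemma orbit_rep_gact g s : orbit_rep (gact g s) = orbit_rep s.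
Proof.
rewrite /orbit_rep; congr (xget _ _); apply/seteqP; split => t [h <-].
  by exists (h * g)%g; rewrite gactM.
by exists (h * g^-1)%g; rewrite gactM gactK.
Qed.

Lemma orbit_rep_id s : orbit_rep (orbit_rep s) = orbit_rep s.
Proof. by have [g gs] := orbit_repP s; rewrite -{1}gs orbit_rep_gact. Qed.

Lemma orbit_rep_inj s t : orbit_rep s = orbit_rep t -> exists g, gact g s = t.
Proof.
have [g gs] := orbit_repP s; have [h ht] := orbit_repP t => e.
by exists (h^-1 * g)%g; rewrite gactM gs e -ht gactK.
Qed.

Lemma big_gact (T : Type) (idx : T) (op : Monoid.com_law idx) g s (F : V -> T) :
  \big[op/idx]_(v <- gact g s) F v = \big[op/idx]_(v <- s) F (act g v).
Proof. by rewrite big_imfset//= => u v _ _; exact: act_inj. Qed.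

End simplex_action.

(** * Stabilizer volumes and the mass transport principle *)

Section mass_transport.
Variables (R : realType) (V : choiceType) (X : simplicial_complex V).
Variables (G : topGroupType) (act : G -> V -> V) (r : nat).
Variable mu : {measure set (borel G) -> \bar R}.
Hypothesis G_hausdorff : hausdorff_space G.
Hypothesis mu_haar : left_haar_measure mu.
Hypothesis G_unimodular : unimodular R G.
Hypothesis G_aut : automorphism_group X act.
Hypothesis G_cocompact : cocompact X act.
Hypothesis links_finite :
  forall s, face X s -> #|` s| = r.+1 -> finite_set (face (link X s)).
Hypothesis stab_compact :
  forall s, face X s -> #|` s| = r.+1 -> compact (stabilizer act s).
Hypothesis stab_measure : forall s, face X s -> (r.+1 <= #|` s|)%N ->
  (0 < mu (stabilizer act s) < +oo)%E.
Implicit Types (s t : {fset V}) (g h : G).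

Local Notation gact := (gact act).
Local Notation transporter := (transporter act).
Local Notation orbit_rep := (orbit_rep act).
Local Notation star := (star X).

(** Compactness is assumed for faces with exactly [r + 1] vertices. Every vertex of [s] lies in such
    a face of [s], so the stabilizer of [s] is the intersection of theirs, a closed subset of a
    compact one. *)
Lemma compact_stabilizer s : face X s -> (r.+1 <= #|` s|)%N ->
  compact (stabilizer act s).
Proof.
move=> Xs rs.
have Xsub t : t \in subs r.+1 s -> face X t.
  rewrite in_subs => /andP[ts /eqP ct]; apply: face_sub Xs ts _.
  by rewrite -cardfs_gt0 ct.
have cl t : t \in subs r.+1 s -> compact (stabilizer act t).
  by move=> ts; apply: stab_compact (Xsub _ ts) _; move: ts; rewrite in_subs => /andP[_ /eqP].
have [t ts ct] := exists_fsubset rs.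
have ts' : t \in subs r.+1 s by rewrite in_subs ts ct eqxx.
apply: subclosed_compact (cl t ts') _; last first.
  by move=> g gs v vt; apply: gs; exact: (fsubsetP ts).
have -> : stabilizer act s = \bigcap_(t in [set` subs r.+1 s]) stabilizer act t.
  apply/seteqP; split => [g gs u /= |g gs v vs].
    by rewrite in_subs => /andP[us _] v vu; apply: gs; exact: (fsubsetP us).
  have [u us cu] : exists2 u, (u `<=` s `\ v)%fset & #|` u| = r.
    apply: exists_fsubset; have := cardfsD1 v s; rewrite vs add1n => sv.
    by move: rs; rewrite sv.
  apply: (gs (v |` u)%fset); last by rewrite !inE eqxx.
  move: us; rewrite fsubsetD1 => /andP[us vu].
  by rewrite /= in_subs fsubUset fsub1set vs us cardfsU1 vu cu add1n /=.
by apply: closed_bigI => u us; apply: compact_closed => //; exact: cl.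
Qed.

Lemma compact_lmul g (A : set G) : compact A -> compact [set (g * x)%g | x in A].
Proof.
move=> cA; apply: (continuous_compact _ cA); apply: continuous_subspaceT => x.
apply: (@continuous_comp _ _ _ (fun x : G => (g, x)) (fun z : G * G => (z.1 * z.2)%g)).
  by apply: cvg_pair => //=; exact: cvg_cst.
exact: mulg_continuous.
Qed.

(** The setwise stabilizer is a finite union of cosets of the pointwise one: one for each ordering
    [w] of the vertices that the group realises, with coset representative [c w]. *)
Lemma compact_transporter s : face X s -> (r.+1 <= #|` s|)%N ->
  compact (transporter s s).
Proof.
move=> Xs rs.
pose c (w : seq V) := xget 1%g [set g : G | map (act g) s = w].
pose P := stabilizer act s.
have -> : transporter s s = \big[setU/set0]_(w <- permutations s |
     `[< exists g, map (act g) s = w >]) [set (c w * x)%g | x in P].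
  rewrite -bigcup_seq_cond; apply/seteqP.
  split => [g gs|g [w /= /andP[pw /asboolP[h hw]] [p Pp <-]]].
    have ps : perm_eq s (map (act g) s).
      apply: uniq_perm; rewrite ?fset_uniq ?map_inj_uniq ?fset_uniq//.
        exact: (@act_inj _ _ _ _ G_aut g).
      move=> v; rewrite -[in LHS]gs; apply/imfsetP/mapP => -[u us ->]; by exists u.
    exists (map (act g) s).
      by rewrite /= mem_permutations perm_sym ps/=; apply/asboolP; exists g.
    have cg : map (act (c (map (act g) s))) s = map (act g) s.
      by apply: (@xgetI _ 1%g [set h : G | map (act h) s = map (act g) s] g).
    exists ((c (map (act g) s))^-1 * g)%g; last by rewrite mulgA mulgV mul1g.
    move=> v vs; rewrite (actM G_aut); move/eq_in_map : cg => /(_ v vs) <-.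
    exact: act_inv G_aut _ _.
  have cw : map (act (c w)) s = w.
    by apply: (@xgetI _ 1%g [set h : G | map (act h) s = w] h).
  rewrite /transporter /= (gactM G_aut).
  have -> : gact p s = s.
    apply/fsetP => v; apply/imfsetP/idP => /= [[u us ->]|vs]; first by rewrite Pp.
    by exists v; rewrite ?Pp.
  apply/fsetP => v; move: pw; rewrite mem_permutations => /perm_mem <-.
  by rewrite -[in RHS]cw; apply/imfsetP/mapP => -[u us ->]; exists u.
rewrite big_seq_cond; elim/big_ind : _ => [|A B|w _]; first exact: compact0.
  exact: compactU.
exact/compact_lmul/compact_stabilizer.
Qed.

Lemma transporter_lmul g s : transporter s (gact g s) = [set (g * x)%g | x in transporter s s].
Proof.
apply/seteqP; split => [h hs|_ [h hs <-]].
  exists (g^-1 * h)%g; last by rewrite mulgA mulgV mul1g.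
  by rewrite /transporter /= (gactM G_aut) hs (gactK G_aut).
by rewrite /transporter /= (gactM G_aut) hs.
Qed.

Lemma transporter_rmul g s :
  transporter s (gact g s) = [set (x * g)%g | x in transporter (gact g s) (gact g s)].
Proof.
apply/seteqP; split => [h hs|_ [h hs <-]].
  exists (h * g^-1)%g; last by rewrite -mulgA mulVg mulg1.
  by rewrite /transporter /= (gactM G_aut) (gactK G_aut).
by rewrite /transporter /= (gactM G_aut).
Qed.

Lemma borel_closed (A : set G) : closed A -> measurable (A : set (borel G)).
Proof.
move=> cA; rewrite -[A]setCK; apply: measurableC.
by apply: sub_sigma_algebra; exact: closed_openC.
Qed.

Lemma measurable_transporter s t : face X s -> (r.+1 <= #|` s|)%N ->
  measurable (transporter s t : set (borel G)).
Proof.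
move=> Xs rs; apply: borel_closed.
have [[g <-]|nog] := pselect (exists g, gact g s = t).
  rewrite transporter_lmul; apply: compact_closed => //.
  exact/compact_lmul/compact_transporter.
rewrite (_ : transporter s t = set0); first exact: closed0.
by apply/seteqP; split => // g gs; apply: nog; exists g.
Qed.

(** The setwise stabilizer is the right one here, since functions live on unordered simplices. *)
Definition stab_volume s : R := fine (mu (transporter s s)).

Lemma stab_volumeE s : face X s -> (r.+1 <= #|` s|)%N ->
  mu (transporter s s) = (stab_volume s)%:E /\ 0 < stab_volume s.
Proof.
move=> Xs rs; have /andP[s0 soo] := stab_measure Xs rs.
have lt_oo : (mu (transporter s s) < +oo)%E.
  by apply: haar_compact mu_haar _ _; exact: compact_transporter.
have gt_0 : (0 < mu (transporter s s))%E.
  apply: lt_le_trans s0 _; apply: le_measure; rewrite ?inE.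
  - apply: borel_closed; apply: compact_closed => //; exact: compact_stabilizer.
  - exact: measurable_transporter.
  - move=> g gs; apply/fsetP => v; apply/imfsetP/idP => /= [[u us ->]|vs].
      by rewrite gs.
    by exists v; rewrite ?gs.
have fin : mu (transporter s s) \is a fin_num by rewrite ge0_fin_numE// ltW.
by rewrite /stab_volume fineK// fine_gt0// gt_0.
Qed.

(** The elements carrying [s] to [gact g s] form a left coset of the first stabilizer and a right
    coset of the second. Left invariance gives the first equality, unimodularity the second. *)
Lemma mu_transporter g s : face X s -> (r.+1 <= #|` s|)%N ->
  mu (transporter s (gact g s)) = mu (transporter s s) /\
  mu (transporter s (gact g s)) = mu (transporter (gact g s) (gact g s)).
Proof.
move=> Xs rs; split.
  by rewrite transporter_lmul (haar_left_invariant mu_haar)//; exact: measurable_transporter.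
rewrite {1}transporter_rmul (G_unimodular mu_haar)//.
by apply: measurable_transporter; rewrite ?(card_gact G_aut)//; exact/(face_gact G_aut).
Qed.

Lemma measure_partition (I : choiceType) (L : {fset I}) (A : set (borel G))
    (B : I -> set (borel G)) :
  measurable A -> (forall i, i \in L -> measurable (B i)) -> (mu A < +oo)%E ->
  (forall x, A x -> exists2 i, i \in L & B i x) ->
  (forall i j x, B i x -> B j x -> i = j) ->
  \sum_(i <- L) fine (mu (A `&` B i)) = fine (mu A).
Proof.
move=> mA mB Aoo AB Binj.
have <- : mu (\big[setU/set0]_(i <- L) (A `&` B i)) = mu A.
  congr (mu _); rewrite -bigcup_fset; apply/seteqP; split => [x [i _ []//]|x Ax].
  by have [i iL Bix] := AB x Ax; exists i.
rewrite measure_fbigsetU; last 2 first.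
- by move=> i iL; apply: measurableI => //; exact: mB.
- apply/trivIsetP => i j _ _ /eqP ij; apply/seteqP; split => // x.
  by move=> [[_ Bi] [_ /(Binj _ _ _ Bi)]].
rewrite big_seq [in RHS]big_seq sum_fine// => i iL.
rewrite ge0_fin_numE//; apply: le_lt_trans Aoo; apply: le_measure; rewrite ?inE//.
by apply: measurableI => //; exact: mB.
Qed.

Definition reps q : {fset {fset V}} :=
  fset_set [set t | exists2 s, face X s /\ #|` s| = q & t = orbit_rep s].

(** Cocompactness enters here: without finiteness [fset_set] would return the empty set. *)
Lemma in_reps q t :
  t \in reps q <-> [/\ face X t, #|` t| = q & orbit_rep t = t].
Proof.
rewrite in_fset_set; last first.
  have [S [Sfin SX SG]] := G_cocompact.
  apply: (@sub_finite_set _ _ [set orbit_rep s | s in S]); last exact: finite_image.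
  move=> _ [s [Xs _] ->]; have [g [u Su ->]] := SG s Xs.
  by exists u => //; rewrite -/(gact g u) (orbit_rep_gact G_aut).
rewrite inE; split => [[s [Xs <-] ->]|[Xt ct rt]]; last by exists t.
have [g gs] := orbit_repP G_aut s; rewrite -{1 2}gs (card_gact G_aut) (orbit_rep_id G_aut).
by split => //; exact/(face_gact G_aut).
Qed.

Lemma orbit_rep_in_reps q s : face X s -> #|` s| = q -> orbit_rep s \in reps q.
Proof.
move=> Xs cs; apply/in_reps; have [g gs] := orbit_repP G_aut s.
by rewrite (orbit_rep_id G_aut) -gs (card_gact G_aut); split=> //; exact/(face_gact G_aut).
Qed.

(** An orbit counts with the inverse volume of its stabilizer, which replaces summation over a
    fundamental domain when stabilizers are not finite. *)
Definition orbit_sum q (phi : {fset V} -> R) : R :=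
  \sum_(s <- reps q) phi s / stab_volume s.

(* Both sides integrate phi (g^-1 s0) t0 = phi s0 (g t0) over the g with
   s0 included in g t0, once along left and once along right cosets. *)
Lemma mass_transport_pair p q (phi : {fset V} -> {fset V} -> R) s0 t0 :
  (r.+1 <= p)%N -> (p <= q)%N ->
  (forall g s t, face X t -> (s `<=` t)%fset -> #|` s| = p -> #|` t| = q ->
     phi (gact g s) (gact g t) = phi s t) ->
  s0 \in reps p -> t0 \in reps q ->
  (\sum_(s <- subs p t0 | orbit_rep s == s0) phi s t0) * stab_volume s0 =
  (\sum_(t <- star q s0 | orbit_rep t == t0) phi s0 t) * stab_volume t0.
Proof.
move=> rp pq phiG /in_reps[Xs0 cs0 rs0] /in_reps[Xt0 ct0 rt0].
have rs0' : (r.+1 <= #|` s0|)%N by rewrite cs0.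
have rt0' : (r.+1 <= #|` t0|)%N by rewrite ct0 (leq_trans rp).
pose Ls := [fset s in subs p t0 | orbit_rep s == s0]%fset.
pose Lt := [fset t in star q s0 | orbit_rep t == t0]%fset.
have LsP s : s \in Ls -> [/\ (s `<=` t0)%fset, face X s, #|` s| = p & orbit_rep s = s0].
  rewrite !inE /= fpowersetE => /andP[/andP[st /eqP cs] /eqP rs]; split=> //.
  by apply: face_sub Xt0 st _; rewrite -cardfs_gt0 cs (leq_trans _ rp).
have LtP t : t \in Lt -> [/\ (s0 `<=` t)%fset, face X t, #|` t| = q & orbit_rep t = t0].
  by rewrite !inE /= => /andP[/(in_star links_finite)[]// Xt st ct /eqP].
(* The measure of the [g] that carry [s] to [s0] and [t0] to [t]. Its row sums ([K1]) and column
   sums ([K2]) are the two stabilizer volumes; unimodularity is used for [K1]. *)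
pose K s t := fine (mu (transporter s s0 `&` transporter t0 t)).
have K1 s : s \in Ls -> \sum_(t <- Lt) K s t = stab_volume s0.
  move=> /LsP[st Xs cs rs].
  have rs' : (r.+1 <= #|` s|)%N by rewrite cs.
  have [g gs] : exists g, gact g s = s0 by apply: (orbit_rep_inj G_aut); rewrite rs rs0.
  have [_ E2] := mu_transporter g Xs rs'.
  rewrite /stab_volume -gs -E2 gs.
  rewrite (measure_partition (A := transporter s s0) (B := transporter t0))//.
  - exact: measurable_transporter.
  - by move=> t _; exact: measurable_transporter.
  - by rewrite -gs E2 gs (stab_volumeE Xs0 rs0').1 ltry.
  - move=> h hs; exists (gact h t0) => //.
    rewrite !inE /= (orbit_rep_gact G_aut) rt0 eqxx andbT.
    apply/(in_star links_finite) => //; rewrite (card_gact G_aut) ct0; split=> //.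
      exact/(face_gact G_aut).
    by rewrite -hs (gactS G_aut).
  - by move=> i j h <- <-.
have K2 t : t \in Lt -> \sum_(s <- Ls) K s t = stab_volume t0.
  move=> /LtP[st Xt ct rt].
  have rt' : (r.+1 <= #|` t|)%N by rewrite ct (leq_trans rp).
  have [g gt] : exists g, gact g t0 = t by apply: (orbit_rep_inj G_aut); rewrite rt rt0.
  have [E1 _] := mu_transporter g Xt0 rt0'.
  rewrite /stab_volume -E1 gt /K; under eq_bigr do rewrite setIC.
  rewrite (measure_partition (A := transporter t0 t) (B := fun s => transporter s s0))//.
  - exact: measurable_transporter.
  - by move=> s /LsP[_ Xs cs _]; apply: measurable_transporter; rewrite ?cs.
  - by rewrite -gt E1 (stab_volumeE Xt0 rt0').1 ltry.
  - move=> h ht; exists (gact h^-1%g s0); last exact: (gactKV G_aut).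
    rewrite !inE /= (orbit_rep_gact G_aut) rs0 eqxx andbT fpowersetE (card_gact G_aut) cs0.
    by rewrite eqxx andbT -(gactS G_aut h) (gactKV G_aut) ht.
  - move=> i j h hi hj; rewrite -(gactK G_aut h i) -(gactK G_aut h j).
    by rewrite (_ : gact h i = gact h j)//; move: hi hj; rewrite /transporter /= => -> ->.
(* Where [K s t] does not vanish, a single [g] carries the pair [(s, t0)] to [(s0, t)], and [phi] is
   invariant. *)
have K3 s t : s \in Ls -> K s t * phi s t0 = K s t * phi s0 t.
  move=> /LsP[st _ cs _].
  have [K0|/set0P[g [gs gt]]] := eqVneq (transporter s s0 `&` transporter t0 t) set0.
    by rewrite /K K0 measure0 !mul0r.
  by move: gs gt; rewrite /transporter /= => <- <-; rewrite phiG.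
rewrite [in LHS]big_fset_condE [in RHS]big_fset_condE -/Ls -/Lt.
transitivity (\sum_(s <- Ls) \sum_(t <- Lt) K s t * phi s t0).
  rewrite mulr_suml; apply: eq_big_seq => s sL.
  by rewrite -mulr_suml (K1 s sL) mulrC.
rewrite exchange_big mulr_suml; apply: eq_big_seq => t tL /=.
rewrite -(K2 t tL) mulrC mulr_suml; apply: eq_big_seq => s sL.
exact: K3.
Qed.

Lemma mass_transport p q (phi : {fset V} -> {fset V} -> R) :
  (r.+1 <= p)%N -> (p <= q)%N ->
  (forall g s t, face X t -> (s `<=` t)%fset -> #|` s| = p -> #|` t| = q ->
     phi (gact g s) (gact g t) = phi s t) ->
  orbit_sum q (fun t => \sum_(s <- subs p t) phi s t) =
  orbit_sum p (fun s => \sum_(t <- star q s) phi s t).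
Proof.
move=> rp pq phiG; rewrite /orbit_sum.
have split_reps (L : {fset {fset V}}) (F : {fset V} -> R) j :
    (forall s, s \in L -> face X s /\ #|` s| = j) ->
    \sum_(s <- L) F s = \sum_(s0 <- reps j) \sum_(s <- L | orbit_rep s == s0) F s.
  move=> LP; rewrite (exchange_big_dep xpredT)//=; apply: eq_big_seq => s sL.
  have [Xs cs] := LP s sL.
  rewrite [RHS]big_mkcond /= (big_fsetD1 (orbit_rep s)) ?orbit_rep_in_reps//= eqxx.
  rewrite big_seq_cond big1 ?addr0//.
  by move=> t; rewrite !inE eq_sym => /andP[/andP[/negPf ->]].
transitivity (\sum_(t0 <- reps q) \sum_(s0 <- reps p)
   (\sum_(s <- subs p t0 | orbit_rep s == s0) phi s t0) / stab_volume t0).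
  apply: eq_big_seq => t0 /in_reps[Xt0 ct0 _].
  rewrite -mulr_suml; congr (_ / _); apply: split_reps => s.
  rewrite in_subs => /andP[st /eqP cs]; split => //.
  by apply: face_sub Xt0 st _; rewrite -cardfs_gt0 cs (leq_trans _ rp).
rewrite exchange_big; apply: eq_big_seq => s0 s0p /=.
have [Xs0 cs0 _] := (in_reps p s0).1 s0p.
have rs0 : (r.+1 <= #|` s0|)%N by rewrite cs0.
rewrite (split_reps (star q s0) (phi s0) q) => [|t /(in_star links_finite)[]//].
rewrite mulr_suml; apply: eq_big_seq => t0 t0q.
have [Xt0 ct0 _] := (in_reps q t0).1 t0q.
have rt0 : (r.+1 <= #|` t0|)%N by rewrite ct0 (leq_trans rp).
apply/eqP; rewrite eqr_div; last 2 first.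
- by rewrite gt_eqF// (stab_volumeE Xt0 rt0).2.
- by rewrite gt_eqF// (stab_volumeE Xs0 rs0).2.
by rewrite (mass_transport_pair rp pq).
Qed.

End mass_transport.

(** * Galleries *)

Section connectivity.
Variable R : realType.

(** The homotopy joins each point to [x0] by a path, and all these paths share [x0]. *)
Lemma contractible_connected (T : topologicalType) :
  contractible R T -> connected [set: T].
Proof.
move=> [x0 [h [hc h0 h1]]].
pose P x := [set h (x, t) | t in `[0, 1]%classic].
have -> : [set: T] = \bigcup_(x in setT) P x.
  apply/seteqP; split => // x _; exists x => //; exists 0; rewrite ?h0//=.
  by rewrite in_itv /= lexx ler01.
apply: bigcup_connected.
  by exists x0 => x _; exists 1; rewrite ?h1//= in_itv /= lexx ler01.
move=> x _; have -> : P x = h @` [set (x, t) | t in `[0, 1]%classic].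
  apply/seteqP; split => [y [t t01 <-]|y [_ [t t01 <-] <-]]; last by exists t.
  by exists (x, t) => //; exists t.
apply: connected_continuous_connected.
  apply: connected_continuous_connected; first exact: segment_connected.
  apply: continuous_subspaceT => t.
  exact: (@cvg_pair _ _ _ (nbhs t) (nbhs x) (nbhs t) _ _ _ (fun=> x) id (cvg_cst x) cvg_id).
apply: continuous_subspaceW hc => _ [t t01 <-] /=.
by move: t01; rewrite /= in_itv.
Qed.

(** The vertices with positive coordinate at a point lie in one face, so either all or none of them
    satisfy [P]. This splits the realization into two open sets. *)
Lemma edge_connected (V : choiceType) (X : simplicial_complex V) (P : V -> Prop) u v :
  connected [set: realization R X] ->
  (forall x y, face X [fset x; y]%fset -> P x -> P y) ->
  vertex X u -> vertex X v -> P u -> P v.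
Proof.
move=> Xc Pedge Xu Xv Pu.
have Pface s x y : face X s -> x \in s -> y \in s -> P x -> P y.
  move=> Xs xs ys; apply: Pedge; apply: face_sub Xs _ _.
    by rewrite fsubUset !fsub1set xs ys.
  by apply/fset0Pn; exists x; rewrite !inE eqxx.
have supp (p : realization R X) : exists s x,
    [/\ face X s, x \in s, 0 < p x & forall y, y \notin s -> p y = 0].
  have [s [Xs s0 s1]] := coord_sum1 p; exists s.
  have [x xs px] : exists2 x, x \in s & 0 < p x.
    apply: contrapT => /forall2NP no; have /eqP := s1; rewrite big_seq big1 => [|x xs].
      by rewrite eq_sym oner_eq0.
    have [//|/negP] := no x; rewrite -leNgt => px.
    by apply/eqP; rewrite eq_le px coord_ge0.
  by exists x; split.
pose U := [set p : realization R X | exists2 w, 0 < p w & P w].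
(* On each closed simplex such a set is empty or everything. *)
have opens (Q : V -> Prop) : (forall s x y, face X s -> x \in s -> y \in s -> Q x -> Q y) ->
    open [set p : realization R X | exists2 w, 0 < p w & Q w].
  move=> Qface.
  suff : realization_open [set p : realization R X | exists2 w, 0 < p w & Q w] by [].
  move=> s Xs.
  have [[x [xs Qx]]|no] := pselect (exists x, x \in s /\ Q x).
    exists setT; first exact: openT.
    apply/seteqP; split => p [_ ps]; split => //.
    have [s' [w [Xs' ws' pw s'0]]] := supp p.
    have ws : w \in s by apply: contraT => /ps pw0; rewrite pw0 ltxx in pw.
    by exists w => //; exact: Qface Xs xs ws Qx.
  exists set0; first exact: open0.
  apply/seteqP; split => p [] // [w pw Qw] ps; exfalso; apply: no; exists w; split=> //.
  by apply: contraT => /ps pw0; rewrite pw0 ltxx in pw.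
have oU : open U by exact: opens.
(* The complement is the set of the same kind for the negation of [P]. *)
have oUc : open (~` U).
  rewrite (_ : ~` U = [set p : realization R X | exists2 w, 0 < p w & ~ P w]).
    by apply: opens => s x y Xs xs ys nPx Py; apply: nPx; exact: Pface Xs ys xs Py.
  apply/seteqP; split => [p nUp|p [w pw nPw] [w' pw' Pw']].
    have [s [w [Xs ws pw s0]]] := supp p; exists w => // Pw.
    by apply: nUp; exists w.
  have [s [_ [Xs _ _ s0]]] := supp p.
  have ins y : 0 < p y -> y \in s.
    by move=> py; apply: contraT => /s0 py0; rewrite py0 ltxx in py.
  by apply: nPw; exact: Pface Xs (ins _ pw') (ins _ pw) Pw'.
have vert x : vertex X x -> exists p : realization R X, forall y, p y = (y == x)%:R.
  move=> Xx; have c0 y : (0 : R) <= (y == x)%:R by case: (_ == _).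
  suff c1 : exists s : {fset V}, [/\ face X s, forall y, y \notin s -> (y == x)%:R = 0 :> R &
      \sum_(y <- s) (y == x)%:R = 1 :> R] by exists (Realization c0 c1).
  exists [fset x]%fset; split => //.
    by move=> y; rewrite inE => /negPf ->.
  by rewrite big_seq_fset1 eqxx.
have [pu pue] := vert u Xu; have [pv pve] := vert v Xv.
have UT : U = setT.
  apply: Xc.
  - by exists pu, u => //; rewrite pue eqxx.
  - by exists U => //; rewrite setTI.
  - by exists U; [rewrite -[U]setCK; exact: open_closedC | rewrite setTI].
have : U pv by rewrite UT.
by move=> [w]; rewrite pve; case: eqP => [-> //|_]; rewrite ltxx.
Qed.

(** * Galleries of simplices in a complex with connected links *)

Section gallery.
Variables (V : choiceType) (X : simplicial_complex V) (n k : nat).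
Hypothesis kn : (k.+1 <= n)%N.
Hypothesis X_connected : connected [set: realization R X].
Hypothesis X_pure : pure_of_dim X n.
Hypothesis links_connected : forall s, face X s -> positive_dim (link X s) ->
  connected [set: realization R (link X s)].

Lemma extend_face s q : face X s -> (#|` s| <= q <= n.+1)%N ->
  exists t, [/\ face X t, (s `<=` t)%fset & #|` t| = q].
Proof.
move=> Xs /andP[sq qn]; have [t [Xt st ct]] := X_pure.2 s Xs.
have [u us cu] : exists2 u, (u `<=` t `\` s)%fset & #|` u| = (q - #|` s|)%N.
  by apply: exists_fsubset; rewrite cardfsDS// ct leq_sub2r.
move: us; rewrite fsubsetD => /andP[ut dus].
exists (s `|` u)%fset; split; last 2 first.
- exact: fsubsetUl.
- rewrite cardfsU (_ : (s `&` u)%fset = fset0) ?cardfs0 ?subn0 ?cu ?subnKC//.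
  by apply/eqP; move: dus; rewrite fdisjoint_sym.
apply: face_sub Xt _ _; first by rewrite fsubUset st.
by rewrite fsetU_eq0 negb_and (face_neq0 Xs).
Qed.

(** For empty [t] the link is [X] itself, which the hypothesis on links of faces does not cover. A
    face with at most [k] vertices has a link of positive dimension, because it lies in an
    [n]-simplex and k + 1 <= n. *)
Lemma link_edge_connected t (P : V -> Prop) u v :
  t = fset0 \/ face X t -> (#|` t| <= k)%N ->
  (forall x y, face (link X t) [fset x; y]%fset -> P x -> P y) ->
  vertex (link X t) u -> vertex (link X t) v -> P u -> P v.
Proof.
move=> [->|Xt] tk Pe.
  have E s : face (link X fset0) s <-> face X s.
    split => [[_ _]|Xs]; first by rewrite fset0U.
    by split; [exact: face_neq0 Xs|exact: fdisjoint0X|rewrite fset0U].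
  move=> /E Xu /E Xv; apply: (edge_connected X_connected _ Xu Xv) => x y xy.
  by apply: Pe; exact/E.
move=> Lu Lv; apply: (edge_connected _ Pe Lu Lv); apply: links_connected => //.
have [s [Xs ts cs]] := X_pure.2 t Xt.
have cst : (1 < #|` (s `\` t)%fset|)%N.
  by rewrite cardfsDS// cs ltn_subRL addn1 ltnS (leq_ltn_trans tk).
exists (s `\` t)%fset => //; split.
- by rewrite -cardfs_gt0 (ltn_trans _ cst).
- by apply/fdisjointP => x xt; rewrite inE xt.
- by rewrite fsetUDl fsetDv fsetD0 (fsetUidPr _ _ _).
Qed.

(** Induction on the number [d] of vertices by which the common face [t] falls short of k + 1, up to
    the empty face. Vertices of the two simplices outside [t] are connected in the link of [t]. For
    an edge [x], [y] of the link, a simplex containing [t], [x] and [y] shares the larger face [x |]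
    t[with simplices on one side and]y |[t] with those on the other. *)
Lemma gallery_constant (T : Type) (f : {fset V} -> T) :
  (forall t s s', face X s -> face X s' -> #|` s| = k.+2 -> #|` s'| = k.+2 ->
     (t `<=` s)%fset -> (t `<=` s')%fset -> #|` t| = k.+1 -> f s = f s') ->
  forall s s', face X s -> face X s' -> #|` s| = k.+2 -> #|` s'| = k.+2 -> f s = f s'.
Proof.
move=> f_adj.
suff H d (t s s' : {fset V}) : #|` t| = (k.+1 - d)%N -> face X s -> face X s' ->
    #|` s| = k.+2 -> #|` s'| = k.+2 -> (t `<=` s)%fset -> (t `<=` s')%fset -> f s = f s'.
  by move=> s s' Xs Xs' cs cs'; apply: (H k.+1 fset0); rewrite ?subnn ?cardfs0 ?fsub0set.
elim: d t s s' => [|d ih] t s s' ct Xs Xs' cs cs' ts ts'.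
  by apply: f_adj ts ts' _; rewrite ?ct ?subn0.
(* Truncated subtraction: beyond k + 1 the face stays empty and there is nothing new to prove. *)
have [dk|kd] := leqP k.+1 d.
  by apply: (ih t) => //; rewrite ct subnS; move: dk; rewrite -subn_eq0 => /eqP ->.
have ck : #|` t|.+1 = (k.+1 - d)%N by rewrite ct subnS prednK// subn_gt0.
have Xt : t = fset0 \/ face X t.
  have [->|t0] := eqVneq t fset0; [by left|right]; exact: face_sub Xs ts t0.
have tk : (#|` t| <= k)%N by rewrite -ltnS ck leq_subr.
have pick s1 : face X s1 -> #|` s1| = k.+2 -> (t `<=` s1)%fset ->
    exists u, [/\ u \in s1, u \notin t & vertex (link X t) u].
  move=> Xs1 cs1 ts1; have : (0 < #|` (s1 `\` t)%fset|)%N.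
    by rewrite cardfsDS// cs1 subn_gt0 ltnS (leq_trans tk).
  rewrite cardfs_gt0 => /fset0Pn[u]; rewrite inE => /andP[ut us1].
  exists u; split => //; split; first by apply/fset0Pn; exists u; rewrite inE.
    by rewrite fdisjointX1.
  apply: face_sub Xs1 _ _; first by rewrite fsubUset ts1 fsub1set.
  by apply/fset0Pn; exists u; rewrite !inE eqxx orbT.
have [u [us ut Lu]] := pick s Xs cs ts; have [u' [us' ut' Lu']] := pick s' Xs' cs' ts'.
pose P v := v \notin t /\ forall s1, face X s1 -> #|` s1| = k.+2 ->
  ((v |` t)%fset `<=` s1)%fset -> f s = f s1.
have cU v : v \notin t -> #|` (v |` t)%fset| = (k.+1 - d)%N.
  by move=> vt; rewrite cardfsU1 vt add1n ck.
suff : P u' by move=> [_]; apply=> //; rewrite fsubUset fsub1set us'.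
apply: (link_edge_connected Xt tk _ Lu Lu').
  move=> x y [_ dxy Xxy] [xt Px].
  have yt : y \notin t.
    by move: dxy; rewrite fdisjoint_sym => /fdisjointP; apply; rewrite !inE eqxx orbT.
  split => // s1 Xs1 cs1 ys1.
  have [s2 [Xs2 xys2 cs2]] : exists s2,
      [/\ face X s2, (t `|` [fset x; y] `<=` s2)%fset & #|` s2| = k.+2].
    apply: extend_face => //; apply/andP; split; last by rewrite ltnS.
    rewrite cardfsU; apply: leq_trans (leq_subr _ _) _; rewrite cardfs2.
    apply: (@leq_trans (#|` t| + 2)%N); last by rewrite addn2 !ltnS.
    by rewrite leq_add2l; case: (x != y).
  have [ts2 xs2 ys2] : [/\ (t `<=` s2)%fset, x \in s2 & y \in s2].
    by move: xys2; rewrite !fsubUset !fsub1set => /andP[-> /andP[-> ->]].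
  rewrite (Px s2)//; last by rewrite fsubUset fsub1set xs2.
  apply: (ih (y |` t)%fset) => //; first exact: cU.
  by rewrite fsubUset fsub1set ys2.
split => // s1 Xs1 cs1 us1; apply: (ih (u |` t)%fset) => //; first exact: cU.
by rewrite fsubUset fsub1set us.
Qed.

End gallery.
End connectivity.

(** * Energy of equivariant functions *)

Section weights.
Variables (R : realType) (V : choiceType) (X : simplicial_complex V).
Variables (G : topGroupType) (act : G -> V -> V) (n r : nat).
Variables (m : seq V -> R) (C : nat -> R).
Hypothesis G_aut : automorphism_group X act.
Hypothesis links_finite :
  forall s, face X s -> #|` s| = r.+1 -> finite_set (face (link X s)).
Hypothesis m_weight : weight_function X n r act m C.
Implicit Types (s t : {fset V}).
Local Notation gact := (gact act).
Local Notation star := (star X).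

Lemma fset_of_seq (t : seq V) s : t =i s -> [fset v in t]%fset = s.
Proof. by move=> ts; apply/fsetP => v; rewrite inE ts. Qed.

Lemma ordered_enum j s : face X s -> #|` s| = j.+1 -> ordered_simplex X j s.
Proof. by move=> Xs cs; split; rewrite ?fset_uniq// (@fset_of_seq s s). Qed.

Lemma weight_fset_gt0 s : face X s -> (r.+1 <= #|` s|)%N -> 0 < m s.
Proof.
move=> Xs rs; apply: (weight_gt0 m_weight (k := #|` s|.-1)).
  by rewrite -ltnS prednK// (leq_trans _ rs).
by apply: ordered_enum => //; rewrite prednK// (leq_trans _ rs).
Qed.

(** A finite set given to [m] stands for its enumeration; invariance under permutations makes that
    choice immaterial. *)
Lemma weight_ordered j (t : seq V) : (r <= j)%N -> ordered_simplex X j t ->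
  m t = m [fset v in t]%fset.
Proof.
move=> rj Ht; have [ut st Xt] := Ht.
apply/esym/(weight_perm m_weight rj Ht)/uniq_perm; rewrite ?fset_uniq//.
by move=> v; rewrite inE.
Qed.

Lemma weight_gact g s : face X s -> (r.+1 <= #|` s|)%N -> m (gact g s) = m s.
Proof.
move=> Xs rs; have s0 : (0 < #|` s|)%N by rewrite (leq_trans _ rs).
have rs' : (r <= #|` s|.-1)%N by rewrite -ltnS prednK.
have Hs : ordered_simplex X #|` s|.-1 s by apply: ordered_enum; rewrite ?prednK.
rewrite -(weight_act m_weight g rs' Hs).
have ug : uniq (map (act g) s).
  by rewrite map_inj_uniq ?fset_uniq//; exact: (@act_inj _ _ _ _ G_aut g).
rewrite (weight_ordered rs' (t := map (act g) s)).
  congr m; congr enum_fset; apply/fsetP => v; rewrite inE.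
  by apply/imfsetP/mapP => -[u us ->]; exists u.
split => //; first by rewrite size_map prednK.
rewrite (_ : [fset v in _]%fset = gact g s); first exact/(face_gact G_aut).
by apply/fsetP => v; rewrite inE; apply/mapP/imfsetP => -[u us ->]; exists u.
Qed.

(** The condition on the weights sums over ordered simplices. Each unordered one has (j+2)!
    orderings of equal weight, which cancels the factorial. *)
Lemma weight_star_sum j t : (r <= j <= n.-1)%N -> face X t -> #|` t| = j.+1 ->
  \sum_(s <- star j.+2 t) m s = C j * m t.
Proof.
move=> rjn Xt ct; have /andP[rj jn] := rjn.
have rt : (r.+1 <= #|` t|)%N by rewrite ct.
have := weight_sum m_weight rjn (ordered_enum Xt ct).
set A := [set s | _].
have AP (u : seq V) : A u ->
    [fset v in u]%fset \in star j.+2 t /\ u \in permutations [fset v in u]%fset.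
  move=> [[uu su Xu] tu]; split.
    apply/(in_star links_finite) => //; split=> //.
      by apply/fsubsetP => v vt; rewrite inE; exact: tu.
    by rewrite card_fseq undup_id.
  rewrite mem_permutations; apply: uniq_perm; rewrite ?fset_uniq// => v.
  by rewrite inE.
have Afin : finite_set A.
  apply: (@sub_finite_set _ _ (\bigcup_(s in [set` star j.+2 t]) [set` permutations s])).
    by move=> u /AP[us up]; exists [fset v in u]%fset.
  by apply: bigcup_finite => [|s _]; [exact: finite_fset|exact: finite_seq].
rewrite fsbig_finite// (_ : \sum_(u <- _) _ = (j.+2)`!%:R * \sum_(s <- star j.+2 t) m s).
  by rewrite -mulrA => /mulfI; apply; rewrite pnatr_eq0 -lt0n fact_gt0.
transitivity (\sum_(s <- star j.+2 t) \sum_(u <- fset_set A | [fset v in u]%fset == s) m u).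
  rewrite (exchange_big_dep xpredT)//=; apply: eq_big_seq => u.
  rewrite in_fset_set// inE => /AP[us _].
  rewrite [RHS]big_mkcond/= (big_fsetD1 [fset v in u]%fset)//= eqxx big_seq_cond.
  rewrite big1 ?addr0// => s; rewrite !inE eq_sym => /andP[/andP[/negPf -> _] _].
  by [].
rewrite mulr_sumr; apply: eq_big_seq => s /(in_star links_finite)[]// Xs ts cs.
have Hs := ordered_enum Xs cs.
rewrite big_fset_condE/= (_ : [fset u in _ | _]%fset = [fset u in permutations s]%fset).
  rewrite big_seq (eq_bigr (fun=> m s)) => [|u].
    rewrite -big_seq big_const_seq iter_addr_0 count_predT mulr_natl; congr (_ *+ _).
    by rewrite card_fseq undup_id ?permutations_uniq// size_permutations ?fset_uniq// cs.
  rewrite inE mem_permutations perm_sym => us.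
  by apply: (weight_perm m_weight _ Hs us); rewrite (leq_trans rj).
apply/fsetP => u; rewrite !inE /= in_fset_set//; apply/andP/idP.
  by move=> [/set_mem/AP[_ up] /eqP <-].
rewrite mem_permutations => us.
have e : [fset v in u]%fset = s by apply/fsetP => v; rewrite inE (perm_mem us).
rewrite e eqxx; split=> //; apply/mem_set; split.
  by split; rewrite ?(perm_uniq us) ?fset_uniq ?(perm_size us) ?e.
by move=> v vt; rewrite (perm_mem us); exact: (fsubsetP ts).
Qed.

Lemma big_star_gact (T : nmodType) q g t (F : {fset V} -> T) :
  face X t -> (r.+1 <= #|` t|)%N ->
  \sum_(s <- star q (gact g t)) F s = \sum_(s <- star q t) F (gact g s).
Proof.
move=> Xt rt.
have -> : star q (gact g t) = [fset gact g s | s in star q t]%fset.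
  apply/fsetP => s; apply/idP/imfsetP => [|[u /= /(in_star links_finite)[]// Xu tu cu ->]].
    move=> /(in_star links_finite)[]; rewrite ?(card_gact G_aut)//.
      exact/(face_gact G_aut).
    move=> Xs ts cs; exists (gact g^-1%g s); last by rewrite (gactKV G_aut).
    apply/(in_star links_finite) => //; rewrite (card_gact G_aut); split=> //.
      exact/(face_gact G_aut).
    by rewrite -(gactS G_aut g) (gactKV G_aut).
  apply/(in_star links_finite); rewrite ?(card_gact G_aut)//.
    exact/(face_gact G_aut).
  by rewrite (gactS G_aut); split => //; exact/(face_gact G_aut).
rewrite big_imfset//= => s u _ _ e.
by rewrite -(gactK G_aut g s) e (gactK G_aut).
Qed.

End weights.

(** * The inequality in the link of a (k-1)-simplex *)

Section link_inequality.
Variables (R : realType) (V : choiceType) (X : simplicial_complex V).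
Variables (G : topGroupType) (act : G -> V -> V) (n r k : nat).
Variables (m : seq V -> R) (C : nat -> R) (lam : R).
Variable (H : hilbertType R).
Hypothesis links_finite :
  forall s, face X s -> #|` s| = r.+1 -> finite_set (face (link X s)).
Hypothesis m_weight : weight_function X n r act m C.
Hypothesis k_range : (r.+1 <= k <= n.-1)%N.
Hypothesis C_gt0 : 0 < C k.
Hypothesis lam_le1 : lam <= 1.
Hypothesis link_gap : forall (t : {fset V}) (l : R), face X t -> #|` t| = k ->
  link_eigenvalue X m (C k) t (C k * l) -> 0 <= l * (l - lam).
Implicit Types (s t : {fset V}) (f : {fset V} -> H).

Local Notation star := (star X).
Local Notation nbr := (nbr X).

(** The divisor is the total weight of the star, by [weight_star_sum]. *)
Definition star_avg f t : H :=
  rscale (C k * m t)^-1 (\sum_(s <- star k.+2 t) rscale (m s) (f s)).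

Definition dev f t s : H := f s - star_avg f t.

Let rk : (r.+1 <= k)%N. Proof. by case/andP: k_range. Qed.
Let rkn : (r <= k <= n.-1)%N.
Proof. by case/andP: k_range => rk' ->; rewrite ltnW. Qed.

Section fixed_face.
Variable t : {fset V}.
Hypotheses (Xt : face X t) (ct : #|` t| = k).

Let rt : (r.+1 <= #|` t|)%N. Proof. by rewrite ct. Qed.

Let L := nbr t.

Let LP (u : V) : u \in L -> [/\ u \notin t, face X (u |` t)%fset & #|` (u |` t)%fset| = k.+1].
Proof. by move=> /(in_nbr links_finite)[]// ut Xut; rewrite cardfsU1 ut ct. Qed.

Let nbrP (u v : V) : u \in L -> v \in nbr (u |` t)%fset <->
  [/\ v != u, v \in L & face X (v |` (u |` t))%fset].
Proof.
move=> /LP[ut Xut cut]; have rut : (r.+1 <= #|` (u |` t)%fset|)%N by rewrite cut ltnW.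
split => [/(in_nbr links_finite)[]// |[vu /LP[vt _ _] Xvut]].
  rewrite !inE negb_or => /andP[vu vt] Xvut; split=> //.
  apply/(in_nbr links_finite) => //; split=> //; apply: face_sub Xvut _ _.
    by apply: fsetUS; exact: fsubsetU1.
  by apply/fset0Pn; exists v; rewrite !inE eqxx.
by apply/(in_nbr links_finite) => //; rewrite !inE negb_or vu.
Qed.

Let nbr_sym (u v : V) : u \in L -> v \in L ->
  (v \in nbr (u |` t)%fset) = (u \in nbr (v |` t)%fset).
Proof.
move=> uL vL; apply/idP/idP => /nbrP[]// ne _ Xf; apply/nbrP => //;
  by rewrite eq_sym fsetUCA.
Qed.

(** The link as a weighted graph on [L], with weight zero off the edges. *)
Let mm (u v : L) : R :=
  if val v \in nbr (val u |` t)%fset then m (val v |` (val u |` t))%fset else 0.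

Let sumL (T : nmodType) (u : L) (Q : V -> T) : \sum_(y <- nbr (val u |` t)%fset) Q y =
  \sum_(v : L) (if val v \in nbr (val u |` t)%fset then Q (val v) else 0).
Proof.
rewrite -(big_seq_fsetE _ _ predT (fun y => if y \in nbr (val u |` t)%fset then Q y else 0)).
rewrite -big_mkcond /= [RHS]big_fset_condE; apply: eq_fbigl => y.
rewrite !inE /= andbC; case: (boolP (y \in nbr _)) => //= /nbrP[]//.
Qed.

(** The weight condition in dimension [k] computes the degrees, so that averages around a vertex of
    the link are star averages in [X]. *)
Let mm_deg (u : L) : \sum_v mm u v = C k * m (val u |` t)%fset.
Proof.
have [ut Xut cut] := LP (valP u).
have rut : (r.+1 <= #|` (val u |` t)%fset|)%N by rewrite cut ltnW.
rewrite -(weight_star_sum links_finite m_weight rkn Xut cut).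
rewrite -cut (sum_star_nbr links_finite)//.
by rewrite (sumL u (fun y => m (y |` (val u |` t))%fset)).
Qed.

Let vertexP (u : V) : vertex (link_of X t) u <-> u \in L.
Proof.
rewrite /link_of (@fset_of_seq _ t t)//; split => [[_ dtu Xtu]|/LP[ut Xut _]].
  by apply/(in_nbr links_finite) => //; rewrite fsetUC; split => //; rewrite -fdisjointX1.
by split; [apply/fset0Pn; exists u; rewrite inE|rewrite fdisjointX1|rewrite fsetUC].
Qed.

Let m_cat (u : V) : u \in L -> m (t ++ [:: u]) = m (u |` t)%fset.
Proof.
move=> /LP[ut Xut cut]; have rk' : (r <= k)%N := ltnW rk.
apply: (weight_perm m_weight rk' (ordered_enum Xut cut)).
apply: uniq_perm; first exact: fset_uniq.
  by rewrite cat_uniq fset_uniq /= orbF andbT ut.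
by move=> v; rewrite mem_cat !inE orbC.
Qed.

Let m_cat2 (u v : V) : u \in L -> v \in nbr (u |` t)%fset ->
  m (t ++ [:: u; v]) = m (v |` (u |` t))%fset.
Proof.
move=> uL vN; have [ut Xut cut] := LP uL; have [vu vL Xvut] := (nbrP v uL).1 vN.
have [vt _ _] := LP vL.
have cvut : #|` (v |` (u |` t))%fset| = k.+2.
  by rewrite cardfsU1 cut !inE negb_or vu vt add1n.
have rk' : (r <= k.+1)%N by rewrite ltnW// ltnW.
apply: (weight_perm m_weight rk' (ordered_enum Xvut cvut)).
apply: uniq_perm; first exact: fset_uniq.
  by rewrite cat_uniq fset_uniq /= !inE !orbF negb_or ut vt eq_sym vu.
by move=> w; rewrite mem_cat !inE; case: (w == u); case: (w == v); case: (w \in t).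
Qed.

Let edgeP (u : V) : u \in L ->
  [set v | ordered_simplex (link_of X t) 1 [:: u; v]] = [set` nbr (u |` t)%fset].
Proof.
move=> uL; have [ut Xut cut] := LP uL; rewrite /link_of (@fset_of_seq _ t t)//.
have E v : [fset w in [:: u; v]]%fset = [fset u; v]%fset.
  by apply/fsetP => w; rewrite !inE orbF.
have E2 v : (t `|` [fset u; v] = v |` (u |` t))%fset.
  by apply/fsetP => w; rewrite !inE; case: (w == u); case: (w == v); case: (w \in t).
apply/seteqP; split => v.
  move=> [/= /andP[]]; rewrite !inE => uv _ _; rewrite E => -[_ dt Xf].
  have vt : v \notin t.
    by move: dt; rewrite fdisjoint_sym => /fdisjointP; apply; rewrite !inE eqxx orbT.
  rewrite /= ; apply/nbrP => //; rewrite eq_sym uv -E2; split=> //.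
  apply/(in_nbr links_finite) => //; split=> //; apply: face_sub Xf _ _.
    by rewrite fsubUset fsub1set !inE eqxx !orbT fsubsetUl.
  by apply/fset0Pn; exists v; rewrite !inE eqxx.
move=> /= /nbrP[]// vu vL Xvut; have [vt _ _] := LP vL.
split; rewrite /= ?inE ?andbT 1?eq_sym// E; split.
- by apply/fset0Pn; exists u; rewrite !inE eqxx.
- by rewrite fdisjoint_sym; apply/fdisjointP => w; rewrite !inE => /orP[]/eqP ->.
- by rewrite E2.
Qed.

(** The local inequality for the edge function [F], whose vertex average at [u] is [star_avg f] at
    [u |] t[. If]x[and]y[are the two vertices of]s[outside]t[, removing]y[leaves]x |[t], so the
    facets of [s] containing [t] are the two ends of the edge. *)
Lemma link_inequality f :
  0 <= \sum_(s <- star k.+2 t) \sum_(x <- (s `\` t)%fset) \sum_(y <- (s `\` (x |` t))%fset)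
    m s * (rdot (dev f (s `\ y)%fset s) (dev f (s `\ x)%fset s) +
          (1 - lam) * rdot (dev f (s `\ y)%fset s) (dev f (s `\ y)%fset s)).
Proof.
rewrite (_ : star k.+2 t = star #|` t|.+2 t); last by rewrite ct.
rewrite (sum_star_pairs links_finite (fun s x y => m s *
   (rdot (dev f (s `\ y)%fset s) (dev f (s `\ x)%fset s) +
          (1 - lam) * rdot (dev f (s `\ y)%fset s) (dev f (s `\ y)%fset s))))//.
pose F (u v : L) := f (val v |` (val u |` t))%fset.
have avgE (u : L) : rscale (\sum_v mm u v)^-1 (\sum_v rscale (mm u v) (F u v)) =
    star_avg f (val u |` t)%fset.
  have [ut Xut cut] := LP (valP u).
  have rut : (r.+1 <= #|` (val u |` t)%fset|)%N by rewrite cut ltnW.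
  rewrite mm_deg /star_avg; congr (rscale _ _).
  rewrite -cut (sum_star_nbr links_finite)//.
  rewrite (sumL u (fun y => rscale (m (y |` (val u |` t))%fset) (f (y |` (val u |` t))%fset))).
  by apply: eq_bigr => v _; rewrite /mm; case: ifP => // _; rewrite rscale0.
have deg_gt0 (u : L) : 0 < \sum_v mm u v.
  have [ut Xut cut] := LP (valP u).
  by rewrite mm_deg mulr_gt0// (weight_fset_gt0 m_weight)// cut ltnW.
have mm_sym u v : mm u v = mm v u.
  by rewrite /mm (nbr_sym (valP u) (valP v)) fsetUCA.
have := @local_inequality R H L mm lam mm_sym _ deg_gt0 _ _ F.
under [X in _ -> _ -> _ -> _ -> 0 <= X]eq_bigr do under eq_bigr do rewrite !avgE.
have -> : \sum_(u : L) \sum_(v : L) mm u v * (rdot (F u v - star_avg f (val u |` t)%fset)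
      (F u v - star_avg f (val v |` t)%fset) + (1 - lam) *
      rdot (F u v - star_avg f (val u |` t)%fset) (F u v - star_avg f (val u |` t)%fset)) =
   \sum_(x <- L) \sum_(y <- nbr (x |` t)%fset) m (y |` (x |` t))%fset *
   (rdot (dev f ((y |` (x |` t)) `\ y)%fset (y |` (x |` t))%fset)
         (dev f ((y |` (x |` t)) `\ x)%fset (y |` (x |` t))%fset) +
     (1 - lam) * rdot (dev f ((y |` (x |` t)) `\ y)%fset (y |` (x |` t))%fset)
         (dev f ((y |` (x |` t)) `\ y)%fset (y |` (x |` t))%fset)).
  rewrite big_seq_fsetE; apply: eq_bigr => u _.
  rewrite (sumL u (fun y => m (y |` (val u |` t))%fset *
   (rdot (dev f ((y |` (val u |` t)) `\ y)%fset (y |` (val u |` t))%fset)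
         (dev f ((y |` (val u |` t)) `\ (val u))%fset (y |` (val u |` t))%fset) +
     (1 - lam) * rdot (dev f ((y |` (val u |` t)) `\ y)%fset (y |` (val u |` t))%fset)
         (dev f ((y |` (val u |` t)) `\ y)%fset (y |` (val u |` t))%fset)))).
  apply: eq_bigr => v _; rewrite /mm.
  case: ifPn => [/(nbrP _ (valP u))[vu vL _]|_]; last by rewrite mul0r.
  have [ut _ _] := LP (valP u); have [vt _ _] := LP vL.
  have -> : ((val v |` (val u |` t)) `\ val v = val u |` t)%fset.
    by rewrite fsetU1K// !inE negb_or vu.
  have -> : ((val v |` (val u |` t)) `\ val u = val v |` t)%fset.
    by rewrite fsetUCA fsetU1K// !inE negb_or eq_sym vu.
  by [].
apply => //.
- move=> u v; rewrite /mm; case: ifPn => // /(nbrP _ (valP u))[vu vL Xf].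
  apply/ltW/(weight_fset_gt0 m_weight) => //.
  have [ut Xut cut] := LP (valP u); have [vt _ _] := LP vL.
  by rewrite cardfsU1 cut !inE negb_or vu vt add1n ltnW// ltnW.
- by apply: le_lt_trans lam_le1 _; rewrite ltr1n.
(* Degrees carry the factor [C k] that [link_laplacian] does not divide by, so the eigenvalue [l]
   becomes [C k * l]. The eigenfunction is extended by zero from [L] to [V]. *)
- move=> l h [u0 hu0] heq; apply: (link_gap Xt ct).
  pose e (v : V) := if insub v is Some w then h w else 0.
  have eE (w : L) : e (val w) = h w by rewrite /e valK.
  exists e; split.
    by exists (val u0); [exact/vertexP/valP|rewrite eE].
  move=> u /vertexP uL; pose w : L := [` uL]%fset.
  rewrite /link_laplacian (edgeP uL) -fsbig_seq ?fset_uniq//.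
  have -> : \sum_(v <- nbr (u |` t)%fset) m (t ++ [:: u; v]) * e v = \sum_v mm w v * h v.
    rewrite (eq_big_seq (fun v => m (v |` (u |` t))%fset * e v)); last first.
      by move=> v vN; rewrite m_cat2.
    rewrite (sumL w (fun v => m (v |` (u |` t))%fset * e v)).
    by apply: eq_bigr => v _; rewrite eE /mm; case: ifP => //; rewrite mul0r.
  have := heq w; rewrite mm_deg m_cat// -[u]/(val w) eE -mulrA => <-.
  by rewrite mulrBr invfM; congr (_ - _); rewrite -mulrA mulVKf// gt_eqF.
- by move=> u v; rewrite /F fsetUCA.
Qed.

End fixed_face.
End link_inequality.

(** * Descent of the energy to an invariant vector *)

Section energy.
Variables (R : realType) (V : choiceType) (X : simplicial_complex V).
Variables (G : topGroupType) (act : G -> V -> V) (n r k : nat).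
Variable mu : {measure set (borel G) -> \bar R}.
Variables (m : seq V -> R) (C : nat -> R) (lam : R).
Variable H : hilbertType R.
Variables (rho : G -> H -> H) (rhoU : unitary_rep rho).
Hypothesis X_connected : connected [set: realization R X].
Hypothesis X_pure : pure_of_dim X n.
Hypothesis links_connected : forall s, face X s -> positive_dim (link X s) ->
  connected [set: realization R (link X s)].
Hypothesis links_finite :
  forall s, face X s -> #|` s| = r.+1 -> finite_set (face (link X s)).
Hypothesis G_hausdorff : hausdorff_space G.
Hypothesis mu_haar : left_haar_measure mu.
Hypothesis G_unimodular : unimodular R G.
Hypothesis G_aut : automorphism_group X act.
Hypothesis G_cocompact : cocompact X act.
Hypothesis stab_compact :
  forall s, face X s -> #|` s| = r.+1 -> compact (stabilizer act s).
Hypothesis stab_measure : forall s, face X s -> (r.+1 <= #|` s|)%N ->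
  (0 < mu (stabilizer act s) < +oo)%E.
Hypothesis m_weight : weight_function X n r act m C.
Hypothesis k_range : (r.+1 <= k <= n.-1)%N.
Hypothesis C_gt0 : 0 < C k.
Hypothesis lam_le1 : lam <= 1.
Hypothesis lam_large : k.+1%:R * (1 - lam) < 1.
Hypothesis link_gap : forall (t : {fset V}) (l : R), face X t -> #|` t| = k ->
  link_eigenvalue X m (C k) t (C k * l) -> 0 <= l * (l - lam).
Implicit Types (s t : {fset V}) (f h : {fset V} -> H).

Local Notation star := (star X).
Local Notation gact := (gact act).
Local Notation star_avg := (star_avg X k m C).
Local Notation dev := (dev X k m C).
Local Notation orbit_sum := (orbit_sum X act mu).
Local Notation volume := (stab_volume act mu).
Local Notation reps := (reps X act).

Let rk : (r.+1 <= k)%N. Proof. by case/andP: k_range. Qed.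
Let rkn : (r <= k <= n.-1)%N.
Proof. by case/andP: k_range => rk' ->; rewrite ltnW. Qed.

Definition equivariant f :=
  forall g s, face X s -> #|` s| = k.+2 -> f (gact g s) = rho g (f s).

Lemma face_facet s x : face X s -> #|` s| = k.+2 -> x \in s ->
  face X (s `\ x)%fset /\ #|` (s `\ x)%fset| = k.+1.
Proof.
move=> Xs cs xs; have csx : #|` (s `\ x)%fset| = k.+1.
  by have := cardfsD1 x s; rewrite xs cs add1n => -[].
by split => //; apply: face_sub Xs (fsubD1set _ _) _; rewrite -cardfs_gt0 csx.
Qed.

Let mass_transport_k p (phi : {fset V} -> {fset V} -> R) :
  (r.+1 <= p)%N -> (p <= k.+2)%N ->
  (forall g s t, face X t -> (s `<=` t)%fset -> #|` s| = p -> #|` t| = k.+2 ->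
     phi (gact g s) (gact g t) = phi s t) ->
  orbit_sum k.+2 (fun t => \sum_(s <- subs p t) phi s t) =
  orbit_sum p (fun s => \sum_(t <- star k.+2 s) phi s t) :=
  @mass_transport _ _ _ _ _ r _ G_hausdorff mu_haar G_unimodular G_aut G_cocompact
    links_finite stab_compact stab_measure p k.+2 phi.

Let repsP q s : s \in reps q -> face X s /\ #|` s| = q.
Proof. by move=> /(in_reps G_aut G_cocompact)[]. Qed.

Let volume_gt0 s : face X s -> (r.+1 <= #|` s|)%N -> 0 < volume s.
Proof.
move=> Xs rs.
by have [] := stab_volumeE G_hausdorff mu_haar G_aut stab_compact stab_measure Xs rs.
Qed.

Let weight_gt0' s : face X s -> (r.+1 <= #|` s|)%N -> 0 < m s.
Proof. exact: weight_fset_gt0 m_weight s. Qed.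

Let weight_ge0 s : face X s -> #|` s| = k.+2 -> 0 <= m s.
Proof. by move=> Xs cs; rewrite ltW// weight_gt0'// cs ltnW// ltnW. Qed.

Lemma eq_orbit_sum q (phi psi : {fset V} -> R) :
  (forall s, face X s -> #|` s| = q -> phi s = psi s) -> orbit_sum q phi = orbit_sum q psi.
Proof. by move=> e; apply: eq_big_seq => s /repsP[Xs cs]; rewrite e. Qed.

Lemma orbit_sumD q (phi psi : {fset V} -> R) :
  orbit_sum q (fun s => phi s + psi s) = orbit_sum q phi + orbit_sum q psi.
Proof. by rewrite -big_split; apply: eq_bigr => s _; rewrite mulrDl. Qed.

Lemma orbit_sumZ q a (phi : {fset V} -> R) :
  orbit_sum q (fun s => a * phi s) = a * orbit_sum q phi.
Proof. by rewrite mulr_sumr; apply: eq_bigr => s _; rewrite mulrA. Qed.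

Lemma le_orbit_sum q (phi psi : {fset V} -> R) : (r.+1 <= q)%N ->
  (forall s, face X s -> #|` s| = q -> phi s <= psi s) ->
  orbit_sum q phi <= orbit_sum q psi.
Proof.
move=> rq le; rewrite /orbit_sum !big_seq; apply: ler_sum => s /repsP[Xs cs].
by rewrite ler_wpM2r ?le// invr_ge0 ltW// volume_gt0// cs.
Qed.

Lemma orbit_sum_ge0 q (phi : {fset V} -> R) : (r.+1 <= q)%N ->
  (forall s, face X s -> #|` s| = q -> 0 <= phi s) -> 0 <= orbit_sum q phi.
Proof.
move=> rq /(@le_orbit_sum q (fun=> 0) phi rq).
by rewrite /orbit_sum big1// => s _; rewrite mul0r.
Qed.

Lemma star_avg_gact f g t : equivariant f -> face X t -> #|` t| = k.+1 ->
  star_avg f (gact g t) = rho g (star_avg f t).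
Proof.
move=> fE Xt ct; have rt : (r.+1 <= #|` t|)%N by rewrite ct ltnW.
rewrite /star_avg (big_star_gact G_aut links_finite)// (weight_gact G_aut m_weight)//.
rewrite (repZ rhoU) (rep_sum rhoU); congr rscale.
apply: eq_big_seq => s /(in_star links_finite)[]// Xs ts cs.
rewrite (repZ rhoU) fE// (weight_gact G_aut m_weight)// cs ltnW// ltnW//.
Qed.

Lemma dev_gact f g t s : equivariant f -> face X t -> #|` t| = k.+1 ->
  face X s -> #|` s| = k.+2 -> dev f (gact g t) (gact g s) = rho g (dev f t s).
Proof. by move=> fE Xt ct Xs cs; rewrite /dev (repB rhoU) fE// star_avg_gact. Qed.

(** Half the gradient of the energy: by [sum_dev_dev], pairing it with [f] gives [energy f]. *)
Definition div f s : H := \sum_(x <- s) dev f (s `\ x)%fset s.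

Lemma div_gact f g s : equivariant f -> face X s -> #|` s| = k.+2 ->
  div f (gact g s) = rho g (div f s).
Proof.
move=> fE Xs cs; rewrite /div (big_gact G_aut) (rep_sum rhoU).
apply: eq_big_seq => x xs; have [Xsx csx] := face_facet Xs cs xs.
by rewrite -(gactD1 G_aut) dev_gact.
Qed.

Lemma star_sum_dev f t (b : H) : face X t -> #|` t| = k.+1 ->
  \sum_(s <- star k.+2 t) m s * rdot (dev f t s) b = 0.
Proof.
move=> Xt ct; have rt : (r.+1 <= #|` t|)%N by rewrite ct ltnW.
under eq_bigr do rewrite /dev rdotDl rdotNl mulrBr.
rewrite sumrB -mulr_suml (weight_star_sum links_finite m_weight rkn Xt ct).
rewrite -rdotZl /star_avg rscaleA divff ?rscale1; last first.
  by rewrite mulf_neq0// gt_eqF// weight_gt0'.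
by rewrite rdot_suml; under eq_bigr do rewrite -rdotZl; rewrite subrr.
Qed.

(** Deviations are orthogonal to averages: mass transport moves the sum to the facets, where the
    deviations over a star have weighted sum zero. *)
Lemma orbit_sum_dev_avg f h : equivariant f -> equivariant h ->
  orbit_sum k.+2 (fun s => m s * \sum_(x <- s) rdot (dev f (s `\ x)%fset s)
                                                (star_avg h (s `\ x)%fset)) = 0.
Proof.
move=> fE hE.
pose phi t s := m s * rdot (dev f t s) (star_avg h t).
rewrite (@eq_orbit_sum _ _ (fun s => \sum_(t <- subs k.+1 s) phi t s)); last first.
  by move=> s Xs cs; rewrite (@sum_facets _ _ s (fun t => phi t s) k.+1)// mulr_sumr.
rewrite mass_transport_k//; last first.
- move=> g t s Xs ts ct cs; rewrite /phi.
  have Xt : face X t by apply: face_sub Xs ts _; rewrite -cardfs_gt0 ct.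
  rewrite dev_gact// star_avg_gact// (rep_rdot rhoU) (weight_gact G_aut m_weight)//.
  by rewrite cs ltnW// ltnW.
- by rewrite ltnW.
by rewrite /orbit_sum big_seq big1// => t /repsP[Xt ct]; rewrite star_sum_dev// mul0r.
Qed.

Definition energy f : R := orbit_sum k.+2 (fun s => m s *
  \sum_(x <- s) rdot (dev f (s `\ x)%fset s) (dev f (s `\ x)%fset s)).

Definition sqnorm f : R := orbit_sum k.+2 (fun s => m s * rdot (f s) (f s)).

Let rk2 : (r.+1 <= k.+2)%N. Proof. by rewrite ltnW// ltnW. Qed.

Lemma energy_ge0 f : 0 <= energy f.
Proof.
apply: orbit_sum_ge0 => // s Xs cs; rewrite mulr_ge0 ?weight_ge0//.
by apply: sumr_ge0 => x _; exact: rdot_ge0.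
Qed.

(** Of the ordered pairs of distinct facets, each facet occurs first in k + 1, which is the origin
    of the factor in front of 1 - lam. *)
Lemma sum_pairs_sq (f : {fset V} -> H) s : #|` s| = k.+2 ->
  \sum_(x <- s) \sum_(y <- (s `\ x)%fset)
    (rdot (dev f (s `\ y)%fset s) (dev f (s `\ x)%fset s) +
      (1 - lam) * rdot (dev f (s `\ y)%fset s) (dev f (s `\ y)%fset s)) =
  rdot (div f s) (div f s) - (1 - k.+1%:R * (1 - lam)) *
    \sum_(x <- s) rdot (dev f (s `\ x)%fset s) (dev f (s `\ x)%fset s).
Proof.
move=> cs; pose d x := dev f (s `\ x)%fset s; pose q x := rdot (d x) (d x).
rewrite -/q; set Q := \sum_(x <- s) q x.
have E x : x \in s -> \sum_(y <- (s `\ x)%fset) (rdot (d y) (d x) + (1 - lam) * q y) =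
    rdot (div f s) (d x) + (1 - lam) * Q - (q x + (1 - lam) * q x).
  move=> xs; rewrite /div rdot_suml /Q mulr_sumr -big_split/=.
  by rewrite [RHS]addrC (big_fsetD1 x xs)/= addKr.
rewrite (eq_big_seq _ E) sumrB !big_split/= -rdot_sumr -/Q -mulr_sumr -/Q.
rewrite big_const_seq count_predT iter_addr_0 cs -[_ *+ k.+2]mulr_natl.
rewrite -mulr_sumr -/Q -/(div f s); ring.
Qed.

(** By [sum_pairs_sq] the difference is a sum over pairs of facets. Sorted by their intersections
    and transported to the (k-1)-simplices, it is a sum of terms that [link_inequality] shows
    nonnegative. *)
Lemma energy_le_div f : equivariant f ->
  (1 - k.+1%:R * (1 - lam)) * energy f <= sqnorm (div f).
Proof.
move=> fE; rewrite -subr_ge0.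
pose psi s x y := m s * (rdot (dev f (s `\ y)%fset s) (dev f (s `\ x)%fset s) +
      (1 - lam) * rdot (dev f (s `\ y)%fset s) (dev f (s `\ y)%fset s)).
pose phi t s := \sum_(x <- (s `\` t)%fset) \sum_(y <- (s `\` (x |` t))%fset) psi s x y.
rewrite -mulNr -orbit_sumZ -orbit_sumD.
rewrite (@eq_orbit_sum _ _ (fun s => \sum_(t <- subs k s) phi t s)); last first.
  move=> s Xs cs; rewrite (@sum_codim2 _ _ _ s (psi s))//.
  rewrite mulrCA -mulrDr mulNr -sum_pairs_sq// mulr_sumr.
  by apply: eq_bigr => x _; rewrite mulr_sumr.
rewrite mass_transport_k//; last 2 first.
- by rewrite ltnW.
- move=> g t s Xs ts ct cs.
  rewrite /phi -(gactD G_aut) (big_gact G_aut).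
  apply: eq_big_seq => x; rewrite inE => /andP[xt xs].
  rewrite -(gactU1 G_aut) -(gactD G_aut) (big_gact G_aut).
  apply: eq_big_seq => y; rewrite inE => /andP[_ ys].
  have [Xsx csx] := face_facet Xs cs xs; have [Xsy csy] := face_facet Xs cs ys.
  rewrite /psi -!(gactD1 G_aut) !dev_gact// !(rep_rdot rhoU).
  by rewrite (weight_gact G_aut m_weight)// cs.
apply: orbit_sum_ge0 => // t Xt ct.
exact: (link_inequality links_finite m_weight k_range C_gt0 lam_le1 link_gap Xt ct f).
Qed.

(** On each star, [h] is its deviation plus its average, and the average part contributes
    nothing. *)
Lemma sum_dev_dev f h : equivariant f -> equivariant h ->
  orbit_sum k.+2 (fun s => m s * \sum_(x <- s) rdot (dev f (s `\ x)%fset s)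
                                                (dev h (s `\ x)%fset s)) =
  orbit_sum k.+2 (fun s => m s * rdot (div f s) (h s)).
Proof.
move=> fE hE; rewrite -[LHS]addr0 -[X in _ + X = _](orbit_sum_dev_avg fE hE) -orbit_sumD.
apply: eq_orbit_sum => s Xs cs /=; rewrite -mulrDr -big_split /div rdot_suml /=.
by congr (_ * _); apply: eq_bigr => x _; rewrite -rdotDr /dev subrK.
Qed.

Lemma energy_le_sqnorm h : equivariant h -> energy h <= k.+2%:R * sqnorm h.
Proof.
move=> hE; rewrite -[leRHS]addr0 -[X in _ <= _ + X](mulr0 (-2)).
rewrite -[X in _ <= _ + _ * X](orbit_sum_dev_avg hE hE).
rewrite -!orbit_sumZ -orbit_sumD; apply: le_orbit_sum => // s Xs cs.
rewrite ![_ * (m s * _)]mulrCA -mulrDr ler_wpM2l ?weight_ge0//.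
have -> : k.+2%:R * rdot (h s) (h s) = \sum_(x <- s) rdot (h s) (h s).
  by rewrite big_const_seq count_predT iter_addr_0 cs mulr_natl.
rewrite mulr_sumr -big_split; apply: ler_sum => x _ /=.
rewrite /dev; move: (star_avg h _) => b; rewrite !rdotE (rdotC b (h s)).
by have := rdot_ge0 b; lra.
Qed.

(** The step 1/(k+2) is the inverse of the bound for the energy in [energy_le_sqnorm]. *)
Definition descent f s : H := f s - rscale k.+2%:R^-1 (div f s).

Lemma descent_equivariant f : equivariant f -> equivariant (descent f).
Proof.
by move=> fE g s Xs cs; rewrite /descent fE// div_gact// (repB rhoU) (repZ rhoU).
Qed.

Lemma dev_descent f t s :
  dev (descent f) t s = dev f t s - rscale k.+2%:R^-1 (dev (div f) t s).
Proof.
have -> : dev (descent f) t s = descent f s - (star_avg f t -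
    rscale k.+2%:R^-1 (star_avg (div f) t)).
  congr (_ - _); rewrite /star_avg !rscale_sumr -sumrB; apply: eq_bigr => u _.
  rewrite /descent !rscaleDr !rscaleN !rscaleA; congr (_ - rscale _ _).
  by ring.
by rewrite /dev /descent rscaleDr rscaleN !opprD !opprK addrACA.
Qed.

(** With g = [div f] and c = 1/(k+2), E(f - c g) = E(f) - 2 c |g|^2 + c^2 E(g). As E(g) <= (k+2)
    |g|^2, the last term takes back at most half of the gain. *)
Lemma energy_descent f : equivariant f ->
  energy (descent f) <= energy f - k.+2%:R^-1 * sqnorm (div f).
Proof.
move=> fE; have gE : equivariant (div f) by move=> g s Xs cs; rewrite div_gact.
have k2 : (0 : R) < k.+2%:R by rewrite ltr0n.
set c := k.+2%:R^-1 : R; have c0 : 0 < c by rewrite invr_gt0.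
have -> : energy (descent f) = energy f - 2 * c * sqnorm (div f) + c ^+ 2 * energy (div f).
  rewrite -[sqnorm _](sum_dev_dev fE gE) -mulNr -!orbit_sumZ -!orbit_sumD.
  apply: eq_orbit_sum => s Xs cs.
  rewrite ![_ * (m s * _)]mulrCA -!mulrDr; congr (_ * _).
  rewrite !mulr_sumr -!big_split; apply: eq_bigr => x _ /=.
  rewrite dev_descent -/c; move: (dev f _ _) (dev (div f) _ _) => u v.
  by rewrite !rdotE (rdotC v u); ring.
have cc : c * k.+2%:R = 1 by rewrite mulVf// gt_eqF.
have : c ^+ 2 * energy (div f) <= c ^+ 2 * (k.+2%:R * sqnorm (div f)).
  by rewrite ler_wpM2l ?sqr_ge0// energy_le_sqnorm.
by rewrite expr2 [_ * (k.+2%:R * _)]mulrA -(mulrA c c k.+2%:R) cc mulr1; lra.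
Qed.

Let theta : R := 1 - k.+2%:R^-1 * (1 - k.+1%:R * (1 - lam)).

Let theta_range : 0 <= theta < 1.
Proof.
have k1 : 0 <= k.+1%:R * (1 - lam) by rewrite mulr_ge0// subr_ge0.
have c0 : (0 : R) < k.+2%:R^-1 by rewrite invr_gt0 ltr0n.
have c1 : (k.+2%:R^-1 : R) <= 1 by rewrite invf_le1 ?ltr0n// ler1n.
rewrite /theta; move: lam_large k1 c0 c1.
move: (k.+1%:R * (1 - lam)) (k.+2%:R^-1) => a c a1 a0 c0 c1.
by apply/andP; split; nra.
Qed.

Lemma energy_descent_le f : equivariant f ->
  energy (descent f) <= theta * energy f.
Proof.
move=> fE; apply: le_trans (energy_descent fE) _.
rewrite /theta mulrBl mul1r lerD2l lerN2 -mulrA ler_wpM2l ?invr_ge0 ?ler0n//.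
exact: energy_le_div.
Qed.

(** [energy_descent] read backwards, as the energy after the step is nonnegative. *)
Lemma sqnorm_div_le f : equivariant f -> sqnorm (div f) <= k.+2%:R * energy f.
Proof.
move=> fE; rewrite -ler_pdivrMl ?ltr0n// -subr_ge0.
exact: le_trans (energy_ge0 _) (energy_descent fE).
Qed.

(** Turns an orbit sum into a bound at each representative; the sum of the finitely many ratios
    stands in for their maximum. *)
Definition rep_bound : R := \sum_(s <- reps k.+2) volume s / m s.

Lemma rep_bound_term s : s \in reps k.+2 -> 0 <= volume s / m s <= rep_bound.
Proof.
have pos u : u \in reps k.+2 -> 0 <= volume u / m u.
  by move=> /repsP[Xu cu]; rewrite divr_ge0 ?weight_ge0// ltW// volume_gt0// cu.
move=> sr; rewrite pos//= /rep_bound (big_fsetD1 s)//= lerDl big_seq.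
by apply: sumr_ge0 => u; rewrite !inE => /andP[_]; exact: pos.
Qed.

Lemma rep_bound_ge0 : 0 <= rep_bound.
Proof.
rewrite /rep_bound big_seq; apply: sumr_ge0 => s /rep_bound_term.
by case/andP.
Qed.

Lemma le_orbit_sum_rep (phi : {fset V} -> R) s (a : R) :
  (forall u, face X u -> #|` u| = k.+2 -> 0 <= phi u) ->
  s \in reps k.+2 -> m s * a <= phi s -> a <= rep_bound * orbit_sum k.+2 phi.
Proof.
move=> phi0 sr le; have [Xs cs] := repsP sr.
have rs : (r.+1 <= #|` s|)%N by rewrite cs.
have m0 := weight_gt0' Xs rs; have v0 := volume_gt0 Xs rs.
have /andP[t0 t1] := rep_bound_term sr.
have le1 : phi s / volume s <= orbit_sum k.+2 phi.
  rewrite /orbit_sum (big_fsetD1 s)//= lerDl big_seq; apply: sumr_ge0 => u.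
  rewrite !inE => /andP[_ /repsP[Xu cu]].
  by rewrite divr_ge0 ?phi0// ltW// volume_gt0// cu.
have p0 : 0 <= orbit_sum k.+2 phi by apply: orbit_sum_ge0.
apply: le_trans (ler_wpM2r p0 t1); apply: le_trans (ler_wpM2l t0 le1).
have -> : volume s / m s * (phi s / volume s) = phi s / m s.
  by field; rewrite !gt_eqF.
by rewrite ler_pdivlMr// mulrC.
Qed.

Let transport_rep s : face X s -> #|` s| = k.+2 ->
  exists g s0, [/\ s0 \in reps k.+2, face X s0, #|` s0| = k.+2 & s = gact g s0].
Proof.
move=> Xs cs; have [g gs] := orbit_repP G_aut s.
have := orbit_rep_in_reps G_aut G_cocompact Xs cs; rewrite -gs => sr.
have [Xs0 cs0] := repsP sr.
by exists g^-1%g, (gact g s); rewrite (gactK G_aut).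
Qed.

Lemma dev_le f s x : equivariant f -> face X s -> #|` s| = k.+2 -> x \in s ->
  rdot (dev f (s `\ x)%fset s) (dev f (s `\ x)%fset s) <= rep_bound * energy f.
Proof.
move=> fE Xs cs xs; have [g [s0 [sr Xs0 cs0 es]]] := transport_rep Xs cs.
have ex : x = act g (act g^-1%g x) by rewrite (actKV G_aut).
move: xs; rewrite es ex (mem_gact G_aut) => xs0; move: (act _ _) xs0 => y ys0.
have [Xy cy] := face_facet Xs0 cs0 ys0.
rewrite -(gactD1 G_aut) dev_gact// (rep_rdot rhoU).
apply: le_orbit_sum_rep sr _ => [u Xu cu|].
  by rewrite mulr_ge0 ?weight_ge0//; apply: sumr_ge0 => z _; exact: rdot_ge0.
rewrite ler_wpM2l ?weight_ge0// (big_fsetD1 y)//= lerDl.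
by apply: sumr_ge0 => z _; exact: rdot_ge0.
Qed.

Lemma div_le f s : equivariant f -> face X s -> #|` s| = k.+2 ->
  rdot (div f s) (div f s) <= rep_bound * (k.+2%:R * energy f).
Proof.
move=> fE Xs cs; have [g [s0 [sr Xs0 cs0 ->]]] := transport_rep Xs cs.
rewrite div_gact// (rep_rdot rhoU).
apply: (@le_trans _ _ (rep_bound * sqnorm (div f))); last first.
  by rewrite ler_wpM2l ?rep_bound_ge0// sqnorm_div_le.
apply: le_orbit_sum_rep sr _ => [u Xu cu|//].
by rewrite mulr_ge0 ?weight_ge0// rdot_ge0.
Qed.

Let iterate f j := iter j descent f.

Let iterate_equivariant f j : equivariant f -> equivariant (iterate f j).
Proof. by move=> fE; elim: j => //= j; exact: descent_equivariant. Qed.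

Let iterate_energy f j : equivariant f -> energy (iterate f j) <= theta ^+ j * energy f.
Proof.
move=> fE; elim: j => [|j ih]; first by rewrite expr0 mul1r.
apply: le_trans (energy_descent_le (iterate_equivariant j fE)) _.
by rewrite exprS -mulrA ler_wpM2l//; case/andP: theta_range.
Qed.

Let sqrt_theta_range : 0 <= Num.sqrt theta < 1.
Proof.
have /andP[t0 t1] := theta_range.
by rewrite sqrtr_ge0/= -[X in _ < X]sqrtr1 ltr_sqrt.
Qed.

Let sqrt_iterate f j a (v : H) : 0 <= a -> equivariant f ->
  rdot v v <= a * energy (iterate f j) ->
  vnorm v <= Num.sqrt (a * energy f) * Num.sqrt theta ^+ j.
Proof.
move=> a0 fE le; have /andP[t0 _] := theta_range.
rewrite -(@ler_pXn2r _ 2)// ?nnegrE ?vnorm_ge0 ?mulr_ge0 ?exprn_ge0 ?sqrtr_ge0//.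
rewrite sqr_vnorm exprMn sqr_sqrtr ?mulr_ge0 ?energy_ge0//.
rewrite -exprM mulnC exprM sqr_sqrtr// -mulrA.
apply: le_trans le _; rewrite ler_wpM2l// mulrC; exact: iterate_energy.
Qed.

(** The sum of the geometric series that bounds the successive steps of the descent, with ratio the
    square root of [theta]. *)
Definition spread : R :=
  k.+2%:R^-1 * Num.sqrt (rep_bound * k.+2%:R) / (1 - Num.sqrt theta).

Lemma spread_ge0 : 0 <= spread.
Proof.
have /andP[_ t1] := sqrt_theta_range.
by rewrite !mulr_ge0 ?invr_ge0 ?sqrtr_ge0// subr_ge0 ltW.
Qed.

Lemma iterate_limit f s : equivariant f -> face X s -> #|` s| = k.+2 ->
  exists2 l, tends (fun j => iterate f j s) l &
             vnorm (f s - l) <= spread * Num.sqrt (energy f).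
Proof.
move=> fE Xs cs; have b0 := rep_bound_ge0.
have c0 : (0 : R) <= k.+2%:R^-1 by rewrite invr_ge0.
have [|j|l lim le] := @geometric_tends R H (fun j => iterate f j s)
  (k.+2%:R^-1 * Num.sqrt (rep_bound * k.+2%:R * energy f)) (Num.sqrt theta) _ sqrt_theta_range.
- by rewrite mulr_ge0// sqrtr_ge0.
- rewrite /iterate /= -/(iterate f j) /descent addrAC subrr add0r vnormN vnormZ.
  rewrite ger0_norm// -(mulrA k.+2%:R^-1) ler_wpM2l//; apply: sqrt_iterate => //.
    by rewrite mulr_ge0.
  by rewrite -mulrA div_le//; exact: iterate_equivariant.
exists l => //; apply: le_trans le _.
rewrite sqrtrM ?mulr_ge0// /spread mulrA -!mulrA ler_wpM2l//.
by rewrite ler_wpM2l ?sqrtr_ge0// mulrC.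
Qed.

(* The limit of the descent has zero energy, so it is constant along galleries,
   and its constant value is an invariant vector. *)
Lemma energy_controls_norm f s :
  (forall v : H, (forall g, rho g v = v) -> v = 0) ->
  equivariant f -> face X s -> #|` s| = k.+2 ->
  vnorm (f s) <= spread * Num.sqrt (energy f).
Proof.
move=> noinv fE Xs cs.
have /choice[F HF] : forall u, exists l, face X u -> #|` u| = k.+2 ->
    tends (fun j => iterate f j u) l /\ vnorm (f u - l) <= spread * Num.sqrt (energy f).
  move=> u; have [[Xu cu]|no] := pselect (face X u /\ #|` u| = k.+2).
    by have [l lim le] := iterate_limit fE Xu cu; exists l.
  by exists 0 => Xu cu; case: no.
(* Stars are finite, so deviations pass to the limit, while those of the iterates tend to zero with
   the energy. *)
have devF u x : face X u -> #|` u| = k.+2 -> x \in u -> dev F (u `\ x)%fset u = 0.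
  move=> Xu cu xu; have [Xux cux] := face_facet Xu cu xu.
  have rux : (r.+1 <= #|` (u `\ x)%fset|)%N by rewrite cux ltnW.
  apply: (@tends_unique _ _ (fun j => dev (iterate f j) (u `\ x)%fset u)).
    apply: tendsD; first exact: (HF u Xu cu).1.
    apply/tendsN/tendsZ/tends_sum => w /(in_star links_finite)[]// Xw _ cw.
    exact/tendsZ/(HF w Xw cw).1.
  move=> e e0.
  have [N HN] := geometric_lt (Num.sqrt (rep_bound * energy f)) sqrt_theta_range e0.
  exists N => j /HN; apply: le_lt_trans; rewrite subr0.
  apply: (sqrt_iterate rep_bound_ge0 fE).
  exact: (dev_le (iterate_equivariant j fE) Xu cu xu).
have F_adj t u w : face X u -> face X w -> #|` u| = k.+2 -> #|` w| = k.+2 ->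
    (t `<=` u)%fset -> (t `<=` w)%fset -> #|` t| = k.+1 -> F u = F w.
  move=> Xu Xw cu cw tu tw ct.
  have facet v : face X v -> #|` v| = k.+2 -> (t `<=` v)%fset -> F v = star_avg F t.
    move=> Xv cv tv; have : #|` (v `\` t)%fset| == 1%N by rewrite cardfsDS// cv ct subSnn.
    move=> /cardfs1P[x ex].
    have xv : x \in v.
      have : x \in (v `\` t)%fset by rewrite ex inE.
      by rewrite inE => /andP[].
    have et : t = (v `\ x)%fset by rewrite -ex fsetDK.
    by have /eqP := devF v x Xv cv xv; rewrite /dev subr_eq0 -et => /eqP.
  by rewrite !facet.
have kn : (k.+1 <= n)%N.
  by case/andP: k_range => rk'; case: (n) => [/(leq_trans rk')|n'].
have Fconst := gallery_constant kn X_connected X_pure links_connected F_adj.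
have Fs0 : F s = 0.
  apply: noinv => g; have Xgs : face X (gact g s) by exact/(face_gact G_aut).
  have cgs : #|` gact g s| = k.+2 by rewrite (card_gact G_aut).
  rewrite -[RHS](Fconst _ _ Xgs Xs cgs cs).
  apply: (tends_unique (rep_tends rhoU g (HF s Xs cs).1)).
  apply: tends_ext (HF _ Xgs cgs).1 => j.
  by rewrite iterate_equivariant.
by have [_] := HF s Xs cs; rewrite Fs0 subr0.
Qed.

End energy.

(** * Property (T) *)

Section spectral_hypothesis.
Variables (R : realType) (V : choiceType) (X : simplicial_complex V).
Variables (m : seq V -> R) (c : R) (k : nat).

(** [minimum] is 0 when no least element exists, so a positive value certifies that it is one. *)
Lemma minimum_le (S : set R) : 0 < minimum S -> forall y, S y -> minimum S <= y.
Proof. by rewrite /minimum; case: xgetP => [x _ []|]; rewrite ?ltxx. Qed.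

Lemma lambda_min_le (t : {fset V}) (l : R) : (0 < k)%N ->
  0 < lambda_min X m c k -> face X t -> #|` t| = k -> 0 < l ->
  link_eigenvalue X m c t l -> lambda_min X m c k <= l.
Proof.
move=> k0 lm0 Xt ct l0 le.
have le1 : lambda_min X m c k <= lambda_link X m c t.
  apply: minimum_le lm0 _ _; exists (t : seq V) => //.
  by apply: ordered_enum => //; rewrite ct prednK.
apply: (le_trans le1); apply: minimum_le; last by split.
exact: lt_le_trans lm0 le1.
Qed.

(** The cap at 1 keeps 1 - lam nonnegative. Since the capped value is nonnegative, l <= 0 satisfies
    the inequality at once, and positive l are covered by the definition of the smallest positive
    eigenvalue. *)
Lemma link_gap_of_lambda_min (t : {fset V}) (l : R) : (0 < k)%N -> 0 < c ->
  0 < lambda_min X m c k -> face X t -> #|` t| = k ->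
  link_eigenvalue X m c t (c * l) ->
  0 <= l * (l - Num.min (lambda_min X m c k / c) 1).
Proof.
move=> k0 c0 lm0 Xt ct le; have [l0|l0] := leP l 0.
  rewrite mulr_le0// subr_le0 (le_trans l0)// le_min ler01 andbT.
  by rewrite divr_ge0 ?ltW.
rewrite mulr_ge0 ?(ltW l0)// subr_ge0 ge_min; apply/orP; left.
by rewrite ler_pdivrMr// mulrC (lambda_min_le k0 lm0 Xt ct)// mulr_gt0.
Qed.

End spectral_hypothesis.

Section average.
Variables (R : realType) (V : choiceType) (X : simplicial_complex V).
Variables (k : nat) (m : seq V -> R) (C : nat -> R) (H : hilbertType R).

Lemma star_avg_near (f : {fset V} -> H) (xi : H) (b : R) (t : {fset V}) :
  0 < C k * m t -> \sum_(s <- star X k.+2 t) m s = C k * m t ->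
  (forall s, s \in star X k.+2 t -> 0 <= m s) ->
  (forall s, s \in star X k.+2 t -> vnorm (f s - xi) <= b) ->
  vnorm (star_avg X k m C f t - xi) <= b.
Proof.
move=> Cm0 Cm m0 fb.
have -> : star_avg X k m C f t - xi =
    rscale (C k * m t)^-1 (\sum_(s <- star X k.+2 t) rscale (m s) (f s - xi)).
  under eq_bigr do rewrite rscaleDr.
  rewrite big_split /= rscaleDr; congr (_ + _).
  have -> : \sum_(s <- star X k.+2 t) rscale (m s) (- xi) = rscale (C k * m t) (- xi).
    by rewrite -Cm; elim/big_rec2 : _ => [|s y1 y2 _ ->]; rewrite ?rscale0// rscaleDl.
  by rewrite rscaleA mulVf ?rscale1// gt_eqF.
rewrite vnormZ gtr0_norm ?invr_gt0// mulrC ler_pdivrMr//.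
apply: le_trans (vnorm_sum _ _ _) _; rewrite -Cm mulr_sumr big_seq [leRHS]big_seq.
apply: ler_sum => s sS; rewrite vnormZ ger0_norm ?m0// mulrC.
by rewrite ler_wpM2r ?m0// fb.
Qed.

End average.

Section equivariant_extension.
Variables (R : realType) (V : choiceType) (X : simplicial_complex V).
Variables (G : topGroupType) (act : G -> V -> V) (k : nat).
Variables (H : hilbertType R) (rho : G -> H -> H).
Hypothesis G_aut : automorphism_group X act.
Hypothesis rhoU : unitary_rep rho.

Definition from_rep (s : {fset V}) : G :=
  xget 1%g [set g | gact act g (orbit_rep act s) = s].

Lemma from_repP s : gact act (from_rep s) (orbit_rep act s) = s.
Proof.
have [g gs] := orbit_repP G_aut s.
apply: (@xgetPex _ 1%g [set g | gact act g (orbit_rep act s) = s]).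
by exists g^-1%g; rewrite /= -gs (gactK G_aut).
Qed.

(** Going from the representative to [s], then by [g], then back from [gact act g s] is an element
    of the stabilizer of the representative, which fixes [eta] there. *)
Lemma extension_equivariant (eta : {fset V} -> H) :
  (forall s, face X s -> #|` s| = k.+2 ->
    forall g, transporter act (orbit_rep act s) (orbit_rep act s) g ->
      rho g (eta (orbit_rep act s)) = eta (orbit_rep act s)) ->
  equivariant X act k rho (fun s => rho (from_rep s) (eta (orbit_rep act s))).
Proof.
move=> eta_fix g s Xs cs; rewrite (orbit_rep_gact G_aut) -(repM rhoU).
rewrite -{1}(eta_fix s Xs cs ((from_rep (gact act g s))^-1 * (g * from_rep s))%g).
  by rewrite -(repM rhoU) mulgA mulgV mul1g.
rewrite /transporter /= !(gactM G_aut) from_repP.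
rewrite -[RHS](gactK G_aut (from_rep (gact act g s))).
by rewrite -[in RHS](orbit_rep_gact G_aut g s) from_repP.
Qed.

End equivariant_extension.

Theorem theorem4p6 (R : realType) (n r k : nat)
  (V : choiceType) (X : simplicial_complex V)
  (G : topGroupType) (act : G -> V -> V)
  (mu : {measure set (borel G) -> \bar R})
  (m : seq V -> R) (C : nat -> R)
  (n_ge2 : (2 <= n)%N)
  (r_le : (r <= n - 2)%N)
  (X_contractible : contractible R (realization R X))
  (X_pure : pure_of_dim X n)
  (links_connected : forall s, face X s -> positive_dim (link X s) ->
    connected [set: realization R (link X s)])
  (links_finite : forall s, face X s -> #|` s| = r.+1 -> finite_set (face (link X s)))
  (G_hausdorff : hausdorff_space G)
  (G_locally_compact : locally_compact [set: G])
  (mu_haar : left_haar_measure mu)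
  (G_unimodular : unimodular R G)
  (G_aut : automorphism_group X act)
  (G_cocompact : cocompact X act)
  (stab_compact : forall s, face X s -> #|` s| = r.+1 -> compact (stabilizer act s))
  (stab_measure : forall s, face X s -> (r.+1 <= #|` s|)%N ->
    (0 < mu (stabilizer act s) < +oo)%E)
  (m_weight : weight_function X n r act m C)
  (k_range : (r.+1 <= k <= n - 1)%N)
  (gap : C k * (k%:R / k.+1%:R) < lambda_min X m (C k) k) :
  property_T R G.
Proof.
rewrite subn1 in k_range; have /andP[rk kn] := k_range.
have k0 : (0 < k)%N by rewrite (leq_ltn_trans _ rk).
have kn' : (k.+1 <= n)%N.
  by move: kn; case: (n) => [/(leq_trans rk)|n'].
have rkn : (r <= k <= n.-1)%N by rewrite kn ltnW.
have weight0 s : face X s -> (r.+1 <= #|` s|)%N -> 0 < m s.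
  exact: weight_fset_gt0 m_weight s.
have X_connected : connected [set: realization R X].
  exact: contractible_connected X_contractible.
have [s0 [Xs0 cs0]] : exists s, face X s /\ #|` s| = k.+2.
  (* A contractible space has a point, so [X] has a face, which purity enlarges. *)
  have [p _] := X_contractible; have [s [Xs _ _]] := coord_sum1 p.
  have [t [Xt _ ct]] := X_pure.2 s Xs.
  have [u ut cu] : exists2 u, (u `<=` t)%fset & #|` u| = k.+2.
    by apply: exists_fsubset; rewrite ct ltnS.
  by exists u; split=> //; apply: face_sub Xt ut _; rewrite -cardfs_gt0 cu.
have C_gt0 : 0 < C k.
  have [x xs0] : exists x, x \in s0 by apply/fset0Pn; rewrite -cardfs_gt0 cs0.
  have [Xt ct] := face_facet Xs0 cs0 xs0.
  have rt : (r.+1 <= #|` (s0 `\ x)%fset|)%N by rewrite ct ltnW.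
  rewrite -(pmulr_lgt0 _ (weight0 _ Xt rt)).
  rewrite -(weight_star_sum links_finite m_weight rkn Xt ct).
  rewrite (big_fsetD1 s0)/=; last by apply/(in_star links_finite) => //; rewrite fsubD1set.
  rewrite ltr_wpDr ?weight0 ?cs0// 1?ltnW ?ltnS// 1?ltnW// big_seq.
  apply: sumr_ge0 => u; rewrite !inE => /andP[_ /(in_star links_finite)[]// Xu _ cu].
  by rewrite ltW// weight0// cu ltnW// ltnW.
have frac0 : 0 < k%:R / k.+1%:R :> R by rewrite divr_gt0 ?ltr0n.
have lm0 : 0 < lambda_min X m (C k) k by apply: lt_trans gap; rewrite mulr_gt0.
pose lam := Num.min (lambda_min X m (C k) k / C k) 1.
have lam_le1 : lam <= 1 by rewrite ge_min lexx orbT.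
have lam_large : k.+1%:R * (1 - lam) < 1.
  have h : k%:R / k.+1%:R < lam.
    rewrite lt_min ltr_pdivlMr// mulrC gap /= ltr_pdivrMr ?ltr0n// mul1r.
    by rewrite ltr_nat.
  rewrite ltr_pdivrMr ?ltr0n// in h.
  have : k.+1%:R = k%:R + 1 :> R by rewrite natr1.
  by move: h; move: (k.+1%:R : R) => K h eK; rewrite mulrBr mulr1 [K * _]mulrC; lra.
have link_gap (t : {fset V}) (l : R) : face X t -> #|` t| = k ->
    link_eigenvalue X m (C k) t (C k * l) -> 0 <= l * (l - lam).
  exact: link_gap_of_lambda_min.
pose S := spread X act k mu m lam.
have S0 : 0 <= S by exact: spread_ge0.
(* A simplex has k + 2 facets, so deviations of norm at most b at the representatives give energy at
   most b^2 W. *)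
pose W := orbit_sum X act mu k.+2 (fun s => m s * k.+2%:R).
(* The vector f(t0) will have norm at most 4 S sqrt(W) kappa and lie within 2 kappa of a unit
   vector. The constant 3 instead of 2 makes this contradictory. *)
pose kappa : R := (4 * S * Num.sqrt W + 3)^-1.
have SW0 : 0 <= 4 * S * Num.sqrt W by rewrite mulr_ge0 ?sqrtr_ge0// mulr_ge0.
have kappa0 : 0 < kappa by rewrite invr_gt0 ltr_wpDl.
(* The simplices sharing a facet with a representative: the energy depends only on the values
   there. *)
pose N := [set u | exists2 s, s \in reps X act k.+2 &
                   exists2 x, x \in s & u \in star X k.+2 (s `\ x)%fset].
have Nfin : finite_set N.
  apply: (@sub_finite_set _ _ (\bigcup_(s in [set` reps X act k.+2])
      \bigcup_(x in [set` s]) [set` star X k.+2 (s `\ x)%fset])).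
    by move=> u [s sr [x xs us]]; exists s => //; exists x.
  apply: bigcup_finite => [|s _]; first exact: finite_fset.
  by apply: bigcup_finite => [|x _]; exact: finite_fset.
have repsP s : s \in reps X act k.+2 -> [/\ face X s, #|` s| = k.+2 & orbit_rep act s = s].
  by move/(in_reps G_aut G_cocompact).
(* The stabilizers serve to find fixed vectors near [xi], the finitely many other elements to carry
   them from the representatives to [N]. *)
pose Q := (\big[setU/set0]_(s <- reps X act k.+2) transporter act s s) `|`
          [set from_rep act u | u in N].
exists kappa, Q; split=> //.
  apply: compactU; last by apply: finite_compact; exact: finite_image.
  rewrite big_seq; elim/big_ind : _ => [|A B|s /repsP[Xs cs _]]; first exact: compact0.
    exact: compactU.
  apply: (compact_transporter G_hausdorff G_aut stab_compact) => //.
  by rewrite cs ltnW// ltnW.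
move=> H rho rhoU.
have [inv|noinv] := pselect (exists2 x : H, x != 0 & forall g, rho g x = x); [by left|right].
move=> xi xi1; apply: contrapT => far.
have near g : Q g -> vnorm (rho g xi - xi) < kappa.
  move=> Qg; rewrite ltNge; apply/negP => le; apply: far; exists g => //.
  by rewrite vnormE lecR.
have xi1' : vnorm xi = 1.
  by move: xi1; rewrite vnormE => /eqP; rewrite eq_complex /= eqxx andbT => /eqP.
(* Equivariance forces the value at a representative to be fixed by its setwise stabilizer, so [xi]
   is first replaced by a nearby fixed vector. *)
have /choice[eta eta_spec] : forall s, exists y : H, s \in reps X act k.+2 ->
    (forall g, transporter act s s g -> rho g y = y) /\ vnorm (y - xi) <= kappa.
  move=> s; have [sr|nsr] := boolP (s \in reps X act k.+2); last by exists 0.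
  have [|g h gs hs|g gs|y yfix yn] :=
    @fixed_vector R G H rho rhoU (transporter act s s) kappa xi.
  - exact: gact1 G_aut s.
  - by rewrite /transporter /= (gactM G_aut) hs.
  - apply/ltW/near; left; rewrite -bigcup_seq; exists s => //.
  - by exists y.
pose f s := rho (from_rep act s) (eta (orbit_rep act s)).
have fE : equivariant X act k rho f.
  apply: (extension_equivariant G_aut rhoU) => s Xs cs.
  exact: (eta_spec _ (orbit_rep_in_reps G_aut G_cocompact Xs cs)).1.
(* One kappa for replacing [xi] by [eta], one for moving [xi] by [from_rep act u]. *)
have f_near u : N u -> vnorm (f u - xi) <= 2 * kappa.
  move=> Nu; have [s sr [x xs us]] := Nu; have [Xs cs _] := repsP s sr.
  have [Xt ct] := face_facet Xs cs xs.
  have rt : (r.+1 <= #|` (s `\ x)%fset|)%N by rewrite ct ltnW.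
  move: us => /(in_star links_finite)[]// Xu _ cu.
  apply: le_trans (vnorm_triangle (rho (from_rep act u) xi) _ _) _.
  have h1 : vnorm (rho (from_rep act u) xi - xi) < kappa by apply: near; right; exists u.
  have [_ h2] := eta_spec _ (orbit_rep_in_reps G_aut G_cocompact Xu cu).
  by rewrite -(repB rhoU) (rep_vnorm rhoU) mulr_natl mulr2n lerD// ltW.
have repN s : s \in reps X act k.+2 -> N s.
  move=> sr; have [Xs cs _] := repsP s sr; exists s => //.
  have [x xs] : exists x, x \in s by apply/fset0Pn; rewrite -cardfs_gt0 cs.
  have [Xt ct] := face_facet Xs cs xs.
  by exists x => //; apply/(in_star links_finite); rewrite ?ct ?fsubD1set// ltnW.
(* Both the value of [f] and its star average, a convex combination of values on [N], are within 2
   kappa of [xi]. *)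
have dev_small s x : s \in reps X act k.+2 -> x \in s ->
    vnorm (dev X k m C f (s `\ x)%fset s) <= 4 * kappa.
  move=> sr xs; have [Xs cs _] := repsP s sr; have [Xt ct] := face_facet Xs cs xs.
  have rt : (r.+1 <= #|` (s `\ x)%fset|)%N by rewrite ct ltnW.
  apply: le_trans (vnorm_triangle xi _ _) _; rewrite [X in _ + X]vnormB.
  have h1 := f_near s (repN s sr).
  have h2 : vnorm (star_avg X k m C f (s `\ x)%fset - xi) <= 2 * kappa.
    apply: star_avg_near.
    - by rewrite mulr_gt0// weight0.
    - exact: (weight_star_sum links_finite m_weight rkn Xt ct).
    - move=> u /(in_star links_finite)[]// Xu _ cu.
      by rewrite ltW// weight0// cu ltnW// ltnW.
    - by move=> u us; apply: f_near; exists s => //; exists x.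
  lra.
have E_small : energy X act k mu m C f <= (4 * kappa) ^+ 2 * W.
  rewrite /energy /W /orbit_sum mulr_sumr big_seq [leRHS]big_seq.
  apply: ler_sum => s sr; have [Xs cs _] := repsP s sr.
  have rs : (r.+1 <= #|` s|)%N by rewrite cs ltnW// ltnW.
  have [_ v0] := stab_volumeE G_hausdorff mu_haar G_aut stab_compact stab_measure Xs rs.
  rewrite [leRHS]mulrA ler_wpM2r ?invr_ge0 ?(ltW v0)// [leRHS]mulrCA.
  rewrite ler_wpM2l ?(ltW (weight0 s Xs rs))//.
  have -> : (4 * kappa) ^+ 2 * k.+2%:R = \sum_(x <- s) (4 * kappa) ^+ 2.
    by rewrite big_const_seq count_predT iter_addr_0 cs mulr_natr.
  rewrite big_seq [leRHS]big_seq; apply: ler_sum => x xs.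
  rewrite -sqr_vnorm ler_pXn2r ?nnegrE ?vnorm_ge0 ?mulr_ge0 ?(ltW kappa0)//.
  exact: dev_small.
have [t0 t0r] : exists s, s \in reps X act k.+2.
  by exists (orbit_rep act s0); exact: (orbit_rep_in_reps G_aut G_cocompact).
have [Xt0 ct0 _] := repsP t0 t0r.
have f_small : vnorm (f t0) <= S * Num.sqrt (energy X act k mu m C f).
  apply: (energy_controls_norm rhoU X_connected X_pure links_connected links_finite
    G_hausdorff mu_haar G_unimodular G_aut G_cocompact stab_compact stab_measure
    m_weight k_range C_gt0 lam_le1 lam_large link_gap _ fE Xt0 ct0) => v vinv.
  by apply/eqP/negPn/negP => v0; apply: noinv; exists v.
have : Num.sqrt (energy X act k mu m C f) <= 4 * kappa * Num.sqrt W.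
  have k4 : 0 <= 4 * kappa by rewrite mulr_ge0// ltW.
  rewrite -[X in _ <= X * _](ger0_norm k4) -sqrtr_sqr -sqrtrM ?sqr_ge0//.
  by rewrite ler_wsqrtr.
move=> /(ler_wpM2l S0) /(le_trans f_small) f_le.
have := f_near t0 (repN t0 t0r).
have := vnormD (f t0) (xi - f t0); rewrite addrC subrK xi1' (vnormB xi).
have kk : kappa * (4 * S * Num.sqrt W + 3) = 1 by rewrite mulVf// gt_eqF// ltr_wpDl.
by move=> h1 h2; move: f_le kappa0; nra.
Qed.
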